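(* Let $Y=XB^*+C^*+\mathcal E$ with $X\in\mathbb R^{n\times p}$, $B^*\in\mathbb R^{p\times m}$, $C^*\in\mathbb R^{n\times m}$, and $\mathcal E\in\mathbb R^{n\times m}$ having independent and identically distributed $N(0,\sigma^2)$ entries. Let $q=\mathrm{rank}(X)$ and $P(C;\lambda)=\sum_{i=1}^nP(\|c_i\|_2;\lambda)$, where $c_i^T$ is the $i$th row of $C$ and the penalty $P(\cdot;\lambda)$ satisfies $P(0;\lambda)=0$ and $P(t;\lambda)\ge P_H(t;\lambda)$ for all $t$, with $$P_H(t;\lambda)=(-t^2/2+\lambda|t|)1_{|t|<\lambda}+(\lambda^2/2)1_{|t|\ge\lambda}.$$ Let $\lambda=A\sigma(m+\log n)^{1/2}$ with $A$ a constant, and let $(\hat B,\hat C)$ be a global minimizer of $$\min_{B,C}\ \tfrac12\|Y-XB-C\|_F^2+P(C;\lambda)\quad\text{subject to }\mathrm{rank}(B)\le r .$$ Then, for any sufficiently large $A$, the following oracle inequality holds for any $(B,C)\in\mathbb R^{p\times m}\times\mathbb R^{n\times m}$ satisfying $\mathrm{rank}(B)\le r$: $$E\{M(\hat B-B^*,\hat C-C^* )\}\ \lesssim\ M(B-B^*,C-C^* )+\sigma^2(q+m)r+P(C;\lambda)+\sigma^2 .$$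
   Context: $M(B,C)=\|XB+C\|_F^2$, with $\|\cdot\|_F$ the Frobenius norm. $\lesssim$ means that the inequality holds up to a multiplicative constant (a constant not depending on the problem quantities $n,m,p,q,r,\sigma,X,B^*,C^*,B,C$); ''sufficiently large $A$'' means $A$ larger than such a constant. No assumption is made on the relative sizes of $n,p,m$ or on $X$. *)

(* Defs.v *)
From HB Require Import structures.
From mathcomp Require Import all_boot all_order all_algebra.
From mathcomp Require Import all_classical all_reals all_analysis.

Set Implicit Arguments.
Unset Strict Implicit.
Unset Printing Implicit Defensive.

Import Order.TTheory GRing.Theory Num.Theory.

Local Open Scope classical_set_scope.
Local Open Scope ring_scope.

Section Deterministic.
Context {R : realType}.

(* On a row vector this is the Euclidean norm; the norm `|A| that the library
   puts on matrices is the entrywise maximum. *)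
Definition frobenius {n m : nat} (A : 'M[R]_(n, m)) : R :=
  Num.sqrt (\sum_(i < n) \sum_(j < m) A i j ^+ 2).

Definition M_loss {n p m : nat} (X : 'M[R]_(n, p)) (B : 'M[R]_(p, m))
    (C : 'M[R]_(n, m)) : R :=
  frobenius (X *m B + C) ^+ 2.

Definition P_H (t lambda : R) : R :=
  if `|t| < lambda then - t ^+ 2 / 2 + lambda * `|t| else lambda ^+ 2 / 2.

(* The entrywise penalty [pen] takes the argument first, then the threshold. *)
Definition row_penalty {n m : nat} (pen : R -> R -> R) (lambda : R)
    (C : 'M[R]_(n, m)) : R :=
  \sum_(i < n) pen (frobenius (row i C)) lambda.

Definition objective {n p m : nat} (pen : R -> R -> R) (lambda : R)
    (X : 'M[R]_(n, p)) (Y : 'M[R]_(n, m)) (B : 'M[R]_(p, m))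
    (C : 'M[R]_(n, m)) : R :=
  2^-1 * frobenius (Y - X *m B - C) ^+ 2 + row_penalty pen lambda C.

Definition is_global_minimizer {n p m : nat} (pen : R -> R -> R) (lambda : R)
    (r : nat) (X : 'M[R]_(n, p)) (Y : 'M[R]_(n, m)) (Bhat : 'M[R]_(p, m))
    (Chat : 'M[R]_(n, m)) : Prop :=
  (\rank Bhat <= r)%N /\
  forall (B : 'M[R]_(p, m)) (C : 'M[R]_(n, m)), (\rank B <= r)%N ->
    objective pen lambda X Y Bhat Chat <= objective pen lambda X Y B C.

End Deterministic.

Section Noise.
Context {d : measure_display} {Omega : measurableType d} {R : realType}.
Variable Pr : probability Omega R.

Definition mutually_independent {I : finType} (Z : I -> {RV Pr >-> R}) : Prop :=
  forall (J : {set I}) (V : I -> set R), (forall i, measurable (V i)) ->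
    Pr (\bigcap_(i in [set` J]) (Z i @^-1` V i)) =
    (\prod_(i in J) Pr (Z i @^-1` V i))%E.

(* [normal_prob] is parameterized by the standard deviation. The laws are
   compared on Borel sets only, since the values that [distribution] and
   [normal_prob] take on other sets are meaningless. *)
Definition is_normal (mu sigma : R) (Z : {RV Pr >-> R}) : Prop :=
  forall V : set R, measurable V ->
    distribution Pr Z V = normal_prob mu sigma V.

Definition iid_normal_entries {n m : nat} (sigma : R)
    (E : 'I_n -> 'I_m -> {RV Pr >-> R}) : Prop :=
  mutually_independent (fun ij : 'I_n * 'I_m => E ij.1 ij.2) /\
  forall i j, is_normal 0 sigma (E i j).

Definition random_matrix {n m : nat} (E : 'I_n -> 'I_m -> {RV Pr >-> R})
    (w : Omega) : 'M[R]_(n, m) :=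
  \matrix_(i < n, j < m) E i j w.

End Noise.

(* Main.v *)
Require Import Defs.
From mathcomp Require Import all_boot all_order all_algebra.
From mathcomp Require Import all_classical all_reals all_analysis.
From mathcomp Require Import measurable_realfun ring lra.

Set Implicit Arguments.
Unset Strict Implicit.
Unset Printing Implicit Defensive.

Import Order.TTheory GRing.Theory Num.Theory.

Local Open Scope classical_set_scope.
Local Open Scope ring_scope.

(* Let [U] and [Uhat] be the fits [X (B - Bstar) + (C - Cstar)] of the competitor
   and of the minimizer.  Minimality gives
     |Uhat|^2 / 2 + P(Chat) <= |U|^2 / 2 + P(C) + <E, G>,   G = Uhat - U = D + Delta,
   with D = X (Bhat - B) of rank at most 2r and Delta = Chat - C.  Let J be the set
   of rows of Delta of norm at least lambda, and split <E, G> row by row.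
   - On a row i in J, Young's inequality leaves |E_i|^2, which exceeds lambda^2 / 16
     only with exponentially small expectation, and P_H = lambda^2 / 2 pays for it.
   - On a row outside J, <E_i, Delta_i> is paid for by P_H(|Delta_i|), which is at
     least lambda |Delta_i| / 2.
   - There remains <E, D restricted to the complement of J>.  For a fixed J, the
     supremum of <E, V> - |V|^2 / 16 over the rank-2r matrices V with columns in a
     given q-dimensional space has an exponential moment of order exp(O((q + m) r)),
     and the union bound over J costs |J| log n, paid for by lambda^2 |J| / 16.
   For the exponential moment, V is written as a product x W of a q x 2r and a
   2r x m matrix; the penalized linear form is a concave quadratic function of each
   entry of x and W, so that all the entries can be rounded to a lattice at a cost
   O(sigma^2 (q + m) r).  Only the moment generating function of a linear form
   is then needed, summed over the lattice with Gaussian weights. *)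

(** * Independence and Gaussian moments *)

Section MeasureTheory.
Context {R : realType}.

Import HBNNSimple.

(** The hypothesis on indicators extends to simple functions by linearity and to [f] by monotone
    convergence. It is used to split one factor off an independent product, and to integrate against
    a normal density. *)
Lemma ge0_integral_density d d' (T : measurableType d) (T' : measurableType d')
    (mu : {measure set T -> \bar R}) (nu : {measure set T' -> \bar R})
    (Z : T -> T') (g : T -> R) (f : T' -> R) :
  measurable_fun setT Z -> measurable_fun setT g -> (forall x, 0 <= g x) ->
  (forall V, measurable V ->
     (\int[mu]_x (g x * \1_V (Z x))%:E = nu V)%E) ->
  measurable_fun setT f -> (forall y, 0 <= f y) ->
  (\int[mu]_x (g x * f (Z x))%:E = \int[nu]_y (f y)%:E)%E.
Proof.
move=> mZ mg g0 gnu mf f0.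
have mEf : measurable_fun setT (fun y => (f y)%:E) by exact/measurable_EFinP.
pose f_ := nnsfun_approx measurableT mEf.
have cvf y : (f_ n y)%:E @[n --> \oo] --> (f y)%:E.
  by apply: (cvg_nnsfun_approx measurableT mEf) => // x _ /=; rewrite lee_fin.
have ndf y m n : (m <= n)%N -> f_ m y <= f_ n y.
  by move=> mn; exact/lefP/nd_nnsfun_approx.
have mfZ n : measurable_fun setT (fun x => f_ n (Z x)).
  exact: (measurableT_comp (measurable_funP (f_ n)) mZ).
transitivity (limn (fun n => \int[nu]_y (f_ n y)%:E))%E; last first.
  rewrite -monotone_convergence//.
  - by apply: eq_integral => y _; apply/cvg_lim.
  - by move=> n; exact/measurable_EFinP/measurable_funP.
  - by move=> n y _; rewrite lee_fin.
  - by move=> y _ m n mn; rewrite lee_fin ndf.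
transitivity (limn (fun n => \int[mu]_x (g x * f_ n (Z x))%:E))%E.
  rewrite -monotone_convergence//.
  - apply: eq_integral => x _; apply/esym/cvg_lim => //.
    under eq_fun do rewrite EFinM.
    by rewrite EFinM; apply: cvgeZl.
  - by move=> n; apply/measurable_EFinP/measurable_funM.
  - by move=> n y _; rewrite lee_fin mulr_ge0.
  - by move=> y _ m n mn; rewrite lee_fin ler_wpM2l// ndf.
congr (limn _); apply/funext => n.
have mpre k : measurable (f_ n @^-1` [set k]).
  by rewrite -[X in measurable X]setTI; exact: (measurable_funP (f_ n)).
have m1 k : measurable_fun setT (fun x => \1_(f_ n @^-1` [set k]) (Z x) : R).
  exact: (measurableT_comp (measurable_indic (mpre k)) mZ).
have k0 k y : 0 <= k * \1_(f_ n @^-1` [set k]) y :> R.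
  have := @nnfun_muleindic_ge0 _ _ R (f_ n) k y.
  by rewrite lee_fin.
transitivity (\sum_(k \in range (f_ n))
    \int[nu]_y (k * \1_(f_ n @^-1` [set k]) y)%:E)%E; last first.
  rewrite -ge0_integral_fsum//.
  - by apply: eq_integral => y _; rewrite fsumEFin// -fimfunE.
  - by move=> r; exact/measurable_EFinP/measurable_funM.
  - by move=> r x _; rewrite lee_fin.
transitivity (\sum_(k \in range (f_ n))
    \int[mu]_x (k * (g x * \1_(f_ n @^-1` [set k]) (Z x)))%:E)%E.
  rewrite -ge0_integral_fsum//.
  - apply: eq_integral => y _; rewrite fsumEFin// fimfunE mulr_fsumr//.
    by congr EFin; apply: eq_fsbigr => k _; rewrite mulrCA.
  - by move=> r; apply/measurable_EFinP/measurable_funM => //; exact: measurable_funM.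
  - by move=> r x _; rewrite lee_fin mulrCA mulr_ge0.
apply: eq_fsbigr => k; rewrite inE => -[t _ ftk].
have k_ge0 : 0 <= k by rewrite -ftk.
under eq_integral do rewrite EFinM.
rewrite ge0_integralZl_EFin//; last 2 first.
- by move=> x _; rewrite lee_fin mulr_ge0.
- by apply/measurable_EFinP/measurable_funM.
under [RHS]eq_integral do rewrite EFinM.
rewrite ge0_integralZl_EFin//; last by exact/measurable_EFinP.
by rewrite gnu// integral_indic// setIT.
Qed.

Section Independence.
Context d (Omega : measurableType d) (Pr : probability Omega R).

(* Induction on the set of indices at which [f] is not an indicator: for indicators
   this is the definition of independence, and one more general factor is allowed
   by comparing two measures on the line. *)
Lemma independent_integral_prod (I : finType) (Z : I -> {RV Pr >-> R})
    (f : I -> R -> R) (a : I -> R) :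
  mutually_independent Z ->
  (forall i, measurable_fun setT (f i)) -> (forall i x, 0 <= f i x) ->
  (forall i, \int[Pr]_w (f i (Z i w))%:E = (a i)%:E)%E ->
  (\int[Pr]_w (\prod_i f i (Z i w))%:E = (\prod_i a i)%:E)%E.
Proof.
move=> indZ mf f0 fa.
have mfZ (h : R -> R) i : measurable_fun setT h ->
    measurable_fun setT (fun w => h (Z i w)).
  by move=> mh; exact: (measurableT_comp mh (measurable_funP (Z i))).
suff H (s : seq I) : forall (f : I -> R -> R) (a : I -> R),
    (forall i, measurable_fun setT (f i)) -> (forall i x, 0 <= f i x) ->
    (forall i, i \notin s -> exists2 V, measurable V & f i = \1_V) ->
    (forall i, \int[Pr]_w (f i (Z i w))%:E = (a i)%:E)%E ->
    (\int[Pr]_w (\prod_i f i (Z i w))%:E = (\prod_i a i)%:E)%E.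
  by apply: (H (enum I)) => // i; rewrite mem_enum.
elim: s => [|i0 s IH] {mf f0 fa} {}f {}a mf f0 fs fa.
  have /choice[V fV] : forall i, exists V, measurable V /\ f i = \1_V.
    by move=> i; have [V mV ->] := fs i isT; exists V.
  have mV i : measurable (V i) by have [] := fV i.
  have mZV i : measurable (Z i @^-1` V i).
    by rewrite -[X in measurable X]setTI; exact: (measurable_funP (Z i)).
  have ZVa i : Pr (Z i @^-1` V i) = (a i)%:E.
    rewrite -fa -[in LHS](setIT (_ @^-1` _)) -integral_indic//.
    by apply: eq_integral => w _; rewrite (fV i).2.
  have := indZ (finset.setTfor I) V mV.
  rewrite (eq_bigr (fun i => (a i)%:E)); last by move=> i _; exact: ZVa.
  rewrite prodEFin (eq_bigl predT); last by move=> i; rewrite inE.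
  move=> <-; rewrite -[X in _ = Pr X]setIT -integral_indic//; last first.
    apply: fin_bigcap_measurable => //.
  apply: eq_integral => w _; congr EFin.
  under eq_bigr => i _ do rewrite (fV i).2.
  rewrite indicE; have [wV|] := pselect (forall i, V i (Z i w)).
    rewrite mem_set => [|i _]; last exact: wV.
    by rewrite big1// => i _; rewrite indicE mem_set.
  move=> /existsNP[i nV]; rewrite memNset; last first.
    by move=> /(_ i); apply: contra_not nV; apply => /=; rewrite inE.
  by rewrite (bigD1 i)//= indicE memNset// mul0r.
pose c := \prod_(i | i != i0) a i.
have a0 i : 0 <= a i.
  by rewrite -lee_fin -fa; apply: integral_ge0 => w _; rewrite lee_fin.
have c0 : 0 <= c by apply: prodr_ge0.
pose g w := \prod_(i | i != i0) f i (Z i w).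
have g0 w : 0 <= g w by apply: prodr_ge0.
have mg : measurable_fun setT g.
  have -> : g = fun w => \prod_i (if i != i0 then f i (Z i w) else 1).
    by apply/funext => w; exact: big_mkcond.
  by apply: measurable_prod => i _; case: (i != i0) => //; exact: mfZ.
transitivity (\int[Pr]_w (g w * f i0 (Z i0 w))%:E)%E.
  by apply: eq_integral => w _; rewrite (bigD1 i0)//= mulrC.
rewrite (@ge0_integral_density _ _ _ _ _ (mscale (NngNum c0) (distribution Pr (Z i0))))//.
- rewrite ge0_integral_mscale//; [|exact/measurable_EFinP|by move=> y _; rewrite lee_fin].
  rewrite ge0_integral_distribution//; [|exact/measurable_EFinP|by move=> y; rewrite lee_fin].
  by rewrite /= fa (bigD1 i0)//= mulrC.
- move=> V mV.
  have mZV : measurable (Z i0 @^-1` V).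
    by rewrite -[X in measurable X]setTI; exact: (measurable_funP (Z i0)).
  (* With the factor at [i0] replaced by [\1_V], only indices in [s] can carry a factor that is not
     an indicator, so the induction hypothesis applies. *)
  pose f' i := if i == i0 then (\1_V : R -> R) else f i.
  pose a' i := if i == i0 then fine (Pr (Z i0 @^-1` V)) else a i.
  have := IH f' a'; rewrite (bigD1 i0)//= /a' eqxx (eq_bigr a); last first.
    by move=> i /negPf ->.
  rewrite -/c mulrC => IH'; rewrite [RHS]/= /mscale/=.
  transitivity (\int[Pr]_w (\prod_i f' i (Z i w))%:E)%E.
    apply: eq_integral => w _; rewrite (bigD1 i0)//= /f' eqxx mulrC; congr (_ * _)%:E.
    by apply: eq_bigr => i /negPf ->.
  rewrite IH' ?EFinM ?fineK ?fin_num_measure//.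
  + by move=> i; rewrite /f'; case: ifP => // _; exact: measurable_indic.
  + by move=> i x; rewrite /f'; case: ifP => // _; rewrite indicE.
  + move=> i is0; rewrite /f'; case: eqVneq => [|ii0]; first by exists V.
    by apply: fs; rewrite inE negb_or ii0.
  + move=> i; rewrite /f' /a'; case: eqVneq => // ->.
    by rewrite fineK ?fin_num_measure// -[in RHS](setIT (_ @^-1` _)) -integral_indic.
Qed.

End Independence.

Section Gaussian.
Context d (Omega : measurableType d) (Pr : probability Omega R).

(* [lebesgue_measure] lives on [measurableTypeR R], whose measurable structure is
   not the canonical one of [R]; [id] is used to go from one to the other. *)
Lemma integral_normal_tilt (sigma m s C : R) (Z : {RV Pr >-> R}) (f : R -> R) :
  is_normal 0 sigma Z -> measurable_fun setT f -> (forall x, 0 <= f x) -> 0 <= C ->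
  (forall x, f x * normal_pdf 0 sigma x = C * normal_pdf m s x) ->
  (\int[Pr]_w (f (Z w))%:E = C%:E)%E.
Proof.
move=> nZ mf f0 C0 fC.
have mEf : measurable_fun setT (fun x => (f x)%:E) by exact/measurable_EFinP.
have := @ge0_integral_distribution _ _ _ _ _ _ Z (fun x => (f x)%:E) mEf.
move=> <-; last by move=> y; rewrite lee_fin.
rewrite -(@ge0_integral_density _ _ (measurableTypeR R) _ lebesgue_measure (distribution Pr Z) id
  (normal_pdf 0 sigma) f)//; last 3 first.

- exact: measurable_normal_pdf.
- by move=> x; exact: normal_pdf_ge0.
- move=> V mV; transitivity (normal_prob 0 sigma V); last by rewrite -nZ.
  rewrite /normal_prob [in RHS]integral_mkcond.
  apply: eq_integral => x _; rewrite patchE indicE /=.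
  by case: (x \in V); rewrite ?mulr1 ?mulr0.
under eq_integral do rewrite mulrC fC EFinM.
rewrite ge0_integralZl_EFin//; last 2 first.
- by move=> x _; rewrite lee_fin normal_pdf_ge0.
- by apply/measurable_EFinP; exact: measurable_normal_pdf.
by rewrite integral_normal_pdf mule1.
Qed.

(** Completing the square: the tilt shifts the mean of the density to [sigma ^+ 2 * u]. *)
Lemma normal_mgf (sigma u : R) (Z : {RV Pr >-> R}) :
  0 < sigma -> is_normal 0 sigma Z ->
  (\int[Pr]_w (expR (u * Z w))%:E = (expR (sigma ^+ 2 * u ^+ 2 / 2))%:E)%E.
Proof.
move=> s0 nZ.
apply: (@integral_normal_tilt sigma (sigma ^+ 2 * u) sigma _ _
  (fun x => expR (u * x))) => //.
- exact: measurableT_comp.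
- move=> x; rewrite normal_pdfE ?gt_eqF// normal_pdfE ?gt_eqF//.
  rewrite mulrCA [RHS]mulrCA; congr (_ * _).
  rewrite /normal_fun -!expRD; congr expR.
  by field; rewrite gt_eqF.
Qed.

(** The tilt halves the Gaussian exponent, hence doubles the variance; [Num.sqrt 2] is the ratio of
    the two normalizing constants. *)
Lemma normal_sqr_mgf (sigma : R) (Z : {RV Pr >-> R}) :
  0 < sigma -> is_normal 0 sigma Z ->
  (\int[Pr]_w (expR ((Z w) ^+ 2 / (4 * sigma ^+ 2)))%:E = (Num.sqrt 2)%:E)%E.
Proof.
move=> s0 nZ.
apply: (@integral_normal_tilt sigma 0 (Num.sqrt 2 * sigma) _ _
  (fun x => expR (x ^+ 2 / (4 * sigma ^+ 2)))) => //.
- by apply: measurableT_comp => //; apply: measurable_funM.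
- have s20 : 0 < Num.sqrt 2 :> R by rewrite sqrtr_gt0.
  move=> x; rewrite normal_pdfE ?gt_eqF// normal_pdfE ?gt_eqF ?mulr_gt0//.
  rewrite /normal_peak exprMn sqr_sqrtr//.
  have -> : 2 * sigma ^+ 2 * pi *+ 2 = 2 * (sigma ^+ 2 * pi *+ 2) :> R.
    by rewrite -mulrA mulrnAr.
  rewrite sqrtrM// [in RHS]invfM [RHS]mulrA [X in _ = X * _]mulrA mulfV ?gt_eqF// mul1r mulrCA.
  congr (_ * _).
  rewrite /normal_fun -!expRD; congr expR.
  by rewrite exprMn sqr_sqrtr//; field; rewrite gt_eqF.
Qed.

End Gaussian.

End MeasureTheory.

(** * Frobenius geometry and low-rank factorizations *)

Section Frobenius.
Context {R : realType}.

(** The trace form reduces the algebra to linearity and cyclicity of the trace. *)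
Definition frob_ip {n m : nat} (A B : 'M[R]_(n, m)) : R := \tr (A *m B^T).

Definition frob_sq {n m : nat} (A : 'M[R]_(n, m)) : R := frob_ip A A.

Lemma frob_ipE n m (A B : 'M[R]_(n, m)) :
  frob_ip A B = \sum_i \sum_j A i j * B i j.
Proof.
rewrite /frob_ip /mxtrace; apply: eq_bigr => i _; rewrite mxE.
by apply: eq_bigr => j _; rewrite mxE.
Qed.

Lemma frob_sqE n m (A : 'M[R]_(n, m)) :
  frob_sq A = \sum_i \sum_j A i j ^+ 2.
Proof. by rewrite /frob_sq frob_ipE. Qed.

Lemma frob_sq_ge0 n m (A : 'M[R]_(n, m)) : 0 <= frob_sq A.
Proof.
by rewrite frob_sqE; apply: sumr_ge0 => i _; apply: sumr_ge0 => j _; rewrite sqr_ge0.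
Qed.

Lemma frobenius_sqr n m (A : 'M[R]_(n, m)) : frobenius A ^+ 2 = frob_sq A.
Proof. by rewrite /frobenius sqr_sqrtr -frob_sqE ?frob_sq_ge0. Qed.

Lemma frob_ipC n m (A B : 'M[R]_(n, m)) : frob_ip A B = frob_ip B A.
Proof. by rewrite /frob_ip -mxtrace_tr trmx_mul trmxK. Qed.

Lemma frob_ipDr n m (A B C : 'M[R]_(n, m)) :
  frob_ip A (B + C) = frob_ip A B + frob_ip A C.
Proof. by rewrite /frob_ip linearD mulmxDr linearD. Qed.

Lemma frob_ipZr n m u (A B : 'M[R]_(n, m)) :
  frob_ip A (u *: B) = u * frob_ip A B.
Proof. by rewrite /frob_ip linearZ -scalemxAr linearZ. Qed.

Lemma frob_ipNr n m (A B : 'M[R]_(n, m)) : frob_ip A (- B) = - frob_ip A B.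
Proof. by rewrite -scaleN1r frob_ipZr mulN1r. Qed.

Lemma frob_sqDZ n m u (A B : 'M[R]_(n, m)) :
  frob_sq (A + u *: B) = frob_sq A + 2 * u * frob_ip A B + u ^+ 2 * frob_sq B.
Proof.
rewrite /frob_sq frob_ipDr frob_ipZr (frob_ipC _ A) (frob_ipC _ B) !frob_ipDr.
by rewrite !frob_ipZr (frob_ipC B A); ring.
Qed.

Lemma frob_sqZ n m u (A : 'M[R]_(n, m)) : frob_sq (u *: A) = u ^+ 2 * frob_sq A.
Proof. by rewrite /frob_sq frob_ipZr frob_ipC frob_ipZr mulrA. Qed.

Lemma frob_ip_mull n m k (V : 'M[R]_(n, k)) (A : 'M[R]_(k, m)) B :
  frob_ip (V *m A) B = frob_ip A (V^T *m B).
Proof. by rewrite frob_ipC (frob_ipC A) /frob_ip trmx_mul mulmxA mxtrace_mulC mulmxA. Qed.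

Lemma frob_ip_mulr n m k (A : 'M[R]_(n, k)) (W : 'M[R]_(k, m)) B :
  frob_ip (A *m W) B = frob_ip A (B *m W^T).
Proof. by rewrite /frob_ip trmx_mul trmxK mulmxA. Qed.

Lemma frob_sq_orthol n m k (V : 'M[R]_(n, k)) (A : 'M[R]_(k, m)) :
  V^T *m V = 1%:M -> frob_sq (V *m A) = frob_sq A.
Proof. by move=> VV; rewrite /frob_sq frob_ip_mull mulmxA VV mul1mx. Qed.

Lemma frob_sq_tr n m (A : 'M[R]_(n, m)) : frob_sq A^T = frob_sq A.
Proof. by rewrite /frob_sq /frob_ip trmxK mxtrace_mulC. Qed.

Lemma frob_sq_row_mx n k1 k2 (A : 'M[R]_(n, k1)) (B : 'M[R]_(n, k2)) :
  frob_sq (row_mx A B) = frob_sq A + frob_sq B.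
Proof. by rewrite /frob_sq /frob_ip tr_row_mx mul_row_col linearD. Qed.

Lemma frob_sq_col_mx n k1 k2 (A : 'M[R]_(k1, n)) (B : 'M[R]_(k2, n)) :
  frob_sq (col_mx A B) = frob_sq A + frob_sq B.
Proof. by rewrite -frob_sq_tr tr_col_mx frob_sq_row_mx !frob_sq_tr. Qed.

Lemma frob_sq0 n m : frob_sq (0 : 'M[R]_(n, m)) = 0.
Proof. by rewrite /frob_sq /frob_ip mul0mx linear0. Qed.

Lemma frob_sq_delta n m i j : frob_sq (delta_mx i j : 'M[R]_(n, m)) = 1.
Proof.
rewrite frob_sqE (bigD1 i)//= (bigD1 j)//= mxE !eqxx expr1n.
rewrite big1 => [|j' /negPf j'j]; last by rewrite mxE j'j andbF expr0n.
rewrite big1 => [|i' /negPf i'i]; first by rewrite !addr0.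
by rewrite big1// => j' _; rewrite mxE i'i expr0n.
Qed.

Lemma frob_sq_gt0 n m (A : 'M[R]_(n, m)) : A != 0 -> 0 < frob_sq A.
Proof.
move=> A0; rewrite lt_neqAle frob_sq_ge0 andbT; apply: contra A0 => /eqP /esym.
rewrite frob_sqE => /eqP; rewrite psumr_eq0 => [/allP h|i _]; last first.
  by apply: sumr_ge0 => j _; rewrite sqr_ge0.
apply/eqP/matrixP => i j; rewrite mxE.
have := h i (mem_index_enum _); rewrite psumr_eq0 => [/allP/(_ j (mem_index_enum _))|].
  by rewrite sqrf_eq0 => /eqP.
by move=> j' _; rewrite sqr_ge0.
Qed.

Lemma peel_orthogonal p n (Y : 'M[R]_(p, n)) (w : 'rV[R]_n) :
  w *m w^T = 1%:M -> (Y - Y *m w^T *m w) *m w^T = 0.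
Proof. by move=> ww; rewrite mulmxBl -(mulmxA _ w) ww mulmx1 subrr. Qed.

(** One Gram-Schmidt step: the residual is orthogonal to the unit vector [w], so its row space lies
    in that of [Y] but misses [w], and the rank drops. *)
Lemma peel_unit_row p n (Y : 'M[R]_(p, n)) : Y != 0 ->
  exists w : 'rV[R]_n, [/\ w *m w^T = 1%:M, (w <= Y)%MS &
    (\rank (Y - Y *m w^T *m w)%R < \rank Y)%N].
Proof.
move=> Y0; have [v vY v0] := elimT rowV0Pn Y0.
have v_gt0 := frob_sq_gt0 v0.
pose w := (Num.sqrt (frob_sq v))^-1 *: v.
have ww : w *m w^T = 1%:M.
  rewrite [LHS]mx11_scalar; congr (_%:M).
  transitivity (frob_sq w); first by rewrite /frob_sq /frob_ip /mxtrace big_ord1.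
  rewrite frob_sqZ exprVn sqr_sqrtr ?ltW//.
  by rewrite mulVf// gt_eqF.
have wY : (w <= Y)%MS by exact: scalemx_sub.
exists w; split => //; apply: rank_ltmx; apply/andP; split.
  by rewrite addmx_sub// eqmx_opp mulmx_sub.
apply: contraT => /negPn YY'.
have : w *m w^T = 0.
  have /submxP[u wE] := submx_trans wY YY'.
  by rewrite {1}wE -(mulmxA u) peel_orthogonal// mulmx0.
rewrite ww => /matrixP/(_ 0 0); rewrite !mxE => /eqP.
by rewrite oner_eq0.
Qed.

Lemma frob_sq_peel p n (Y : 'M[R]_(p, n)) (w : 'rV[R]_n) : w *m w^T = 1%:M ->
  frob_sq (Y - Y *m w^T *m w) = frob_sq Y - frob_sq (Y *m w^T).
Proof.
move=> ww; rewrite -scaleN1r frob_sqDZ frob_ipC frob_ip_mulr.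
have -> : frob_sq (Y *m w^T *m w) = frob_sq (Y *m w^T).
  by rewrite {1}/frob_sq frob_ip_mulr -(mulmxA _ w) ww mulmx1.
by rewrite -[frob_ip _ _]/(frob_sq _); ring.
Qed.

(** Repeated peeling stands in for a singular value decomposition. By Pythagoras the columns of [x]
    share out at most the squared norm of [y], and each row of [W] is a unit vector or zero. *)
Lemma low_rank_factor q m k (y : 'M[R]_(q, m)) : (\rank y <= k)%N ->
  exists (x : 'M[R]_(q, k)) (W : 'M[R]_(k, m)),
    [/\ y = x *m W, frob_sq x <= frob_sq y & frob_sq W <= k%:R].
Proof.
elim: k y => [|k IH] y yk.
  exists 0, 0; have -> : y = 0 by apply/eqP; rewrite -mxrank_eq0 -leqn0.
  by rewrite !frob_sq0 mulmx0.
have [y0|/peel_unit_row[w [ww _ rk]]] := eqVneq y 0.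
  by exists 0, 0; rewrite y0 mul0mx !frob_sq0.
have [x [W [yE xy Wk]]] := IH _ (leq_trans rk yk).
exists (row_mx (y *m w^T) x : 'M[R]_(q, 1 + k)), (col_mx w W : 'M[R]_(1 + k, m)).
split.
- by rewrite (@mul_row_col _ q 1 k m) -yE addrC subrK.
- by rewrite (@frob_sq_row_mx q 1 k); move: xy; rewrite frob_sq_peel// lerBrDl.
- rewrite (@frob_sq_col_mx m 1 k) -natr1 addrC lerD//.
  by rewrite /frob_sq /frob_ip ww mxtrace1.
Qed.

(** Gram-Schmidt by peeling. The inclusion of [W] in the row space is carried through the induction
    to make the later rows orthogonal to [w]. *)
Lemma orthonormal_row_basis p n (Y : 'M[R]_(p, n)) :
  exists q (W : 'M[R]_(q, n)), [/\ (q <= \rank Y)%N, W *m W^T = 1%:M,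
    Y *m W^T *m W = Y & (W <= Y)%MS].
Proof.
have [k] := ubnP (\rank Y); elim: k Y => // k IH Y Yk.
have [->|/peel_unit_row[w [ww wY rk]]] := eqVneq Y 0.
  exists 0%N, 0; rewrite !mul0mx sub0mx; split => //.
  by apply/matrixP => -[].
have [q [W [qY' WW Y'W WY']]] := IH _ (leq_trans rk Yk).
have Ww : W *m w^T = 0.
  have /submxP[u ->] := WY'.
  by rewrite -(mulmxA u) peel_orthogonal// mulmx0.
have wW : w *m W^T = 0 by rewrite -[LHS]trmxK trmx_mul trmxK Ww trmx0.
exists (1 + q)%N, (col_mx w W); split.
- exact: leq_ltn_trans rk.
- by rewrite tr_col_mx mul_col_row ww WW wW Ww -scalar_mx_block.
- rewrite tr_col_mx mul_mx_row mul_row_col.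
  have /eqP := Y'W; rewrite !mulmxBl -!(mulmxA (Y *m w^T)) wW !(mulmx0, mul0mx).
  by rewrite subr0 => /eqP ->; rewrite addrC subrK.
- rewrite col_mx_sub wY (submx_trans WY')//.
  by rewrite addmx_sub// eqmx_opp mulmx_sub.
Qed.

End Frobenius.

(** * Rounding of low-rank factors to a lattice *)

Section Rounding.
Context {R : realType}.

(* [Phi] is a quadratic function of each entry, with leading coefficient [- g i j];
   rounding an entry in the direction in which the linear part does not decrease
   costs at most [g i j * delta ^+ 2]. *)
Lemma coordinate_rounding h w (Phi : 'M[R]_(h, w) -> R)
    (b : 'M[R]_(h, w) -> 'I_h -> 'I_w -> R) (g : 'I_h -> 'I_w -> R) (delta : R) :
  0 < delta -> (forall i j, 0 <= g i j) ->
  (forall A i j u,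
     Phi (A + u *: delta_mx i j) = Phi A + u * b A i j - u ^+ 2 * g i j) ->
  forall A, exists z : 'M[int]_(h, w),
    Phi A - delta ^+ 2 * \sum_i \sum_j g i j <= Phi (delta *: map_mx intr z).
Proof.
move=> d0 g0 PhiD A.
suff H (s : seq ('I_h * 'I_w)) : exists A' : 'M[R]_(h, w),
    (forall ij, ij \in s -> exists z : int, A' ij.1 ij.2 = delta * z%:~R) /\
    Phi A - delta ^+ 2 * \sum_(ij <- s) g ij.1 ij.2 <= Phi A'.
  have [A' [A'z PhiA']] := H (index_enum _).
  have /choice[z zA'] : forall ij, exists z : int, A' ij.1 ij.2 = delta * z%:~R.
    by move=> ij; apply: A'z; rewrite mem_index_enum.
  exists (\matrix_(i, j) z (i, j)); rewrite pair_bigA/=.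
  suff -> : delta *: map_mx intr (\matrix_(i, j) z (i, j)) = A' by [].
  by apply/matrixP => i j; rewrite !mxE (zA' (i, j)).
elim: s => [|[i j] s [A' [A'z PhiA']]].
  by exists A; rewrite big_nil mulr0 subr0.
pose z := Num.floor (A' i j / delta).
pose f := A' i j / delta - z%:~R.
have /andP[f0 f1] : (0 <= f) && (f <= 1).
  have /andP[zl zu] := floor_itv (A' i j / delta).
  by rewrite subr_ge0 zl/= lerBlDr addrC (le_trans (ltW zu))// intrD.
have A'E : A' i j = delta * (z%:~R + f).
  by rewrite /f addrC subrK mulrCA mulfV ?mulr1// gt_eqF.
have [u [uz uPhi]] : exists u, (exists z : int, A' i j + u = delta * z%:~R) /\
    Phi A' - delta ^+ 2 * g i j <= Phi (A' + u *: delta_mx i j).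
  have [b0|b0] := leP (b A' i j) 0.
    exists (- (delta * f)); split; first by exists z; rewrite A'E; ring.
    rewrite PhiD.
    have : 0 <= delta ^+ 2 * g i j * (1 - f ^+ 2).
      apply: mulr_ge0; first by rewrite mulr_ge0 ?exprn_ge0// ltW.
      by rewrite subr_ge0 expr_le1.
    have : 0 <= delta * f * - b A' i j by rewrite !mulr_ge0// ?oppr_ge0// ltW.
    lra.
  exists (delta * (1 - f)); split.
    by exists (z + 1); rewrite A'E intrD; ring.
  rewrite PhiD.
  have : 0 <= delta ^+ 2 * g i j * (1 - (1 - f) ^+ 2).
    apply: mulr_ge0; first by rewrite mulr_ge0 ?exprn_ge0// ltW.
    by rewrite subr_ge0 expr_le1 ?subr_ge0// gerBl.
  have : 0 <= delta * (1 - f) * b A' i j by rewrite !mulr_ge0// ?subr_ge0// ltW.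
  lra.
exists (A' + u *: delta_mx i j); split; last first.
  rewrite big_cons/= mulrDr opprD; move: PhiA' uPhi; lra.
move=> [i' j']; rewrite inE !mxE/=.
have [/eqP[-> -> _]|ij /=] := boolP ((i', j') == (i, j)).
  by rewrite !eqxx mulr1.
move=> /A'z/= [z' ->]; exists z'.
by move: ij; rewrite xpair_eqE => /negPf ->; rewrite mulr0 addr0.
Qed.

(** This totals the quadratic coefficients met when rounding a right factor: [x *m delta_mx i j] is
    column [i] of [x] placed in column [j]. *)
Lemma frob_sq_mul_delta_sum n k m (x : 'M[R]_(n, k)) :
  \sum_(i < k) \sum_(j < m) frob_sq (x *m delta_mx i j) = m%:R * frob_sq x.
Proof.
under eq_bigr => i _.
  under eq_bigr => j _.
    have -> : frob_sq (x *m delta_mx i j) = \sum_a x a i ^+ 2.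
      rewrite frob_sqE; apply: eq_bigr => a _.
      rewrite (bigD1 j)//= big1 ?addr0 => [|j' j'j].
        rewrite mxE (bigD1 i)//= big1 ?addr0 ?mxE ?eqxx ?mulr1// => i' /negPf i'i.
        by rewrite mxE i'i mulr0.
      rewrite mxE big1 ?expr0n// => i' _.
      by rewrite mxE (negPf j'j) andbF mulr0.
    over.
  rewrite sumr_const card_ord -mulr_natl; over.
by rewrite -mulr_sumr exchange_big -frob_sqE.
Qed.

Lemma frob_sq_delta_mul_sum n k m (W : 'M[R]_(k, m)) :
  \sum_(i < n) \sum_(j < k) frob_sq (delta_mx i j *m W) = n%:R * frob_sq W.
Proof.
rewrite -[in RHS]frob_sq_tr -frob_sq_mul_delta_sum exchange_big/=.
apply: eq_bigr => i _; apply: eq_bigr => j _.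
by rewrite -frob_sq_tr trmx_mul trmx_delta.
Qed.

(* [W] is rounded first, with mesh [1 / sqrt m], then [x], with mesh
   [sqrt (s / (2 c))]; the terms in [frob_sq x] and [frob_sq W] kept on the right
   make the sum over the lattice converge. *)
Lemma lattice_domination q m k (c s : R) (G y : 'M[R]_(q, m)) :
  0 < c -> 0 < s -> (0 < m)%N -> (\rank y <= k)%N ->
  let kap := (q + m)%:R * s in
  exists (a : 'M[int]_(q, k)) (b : 'M[int]_(k, m)),
    let x := Num.sqrt (s / (2 * c)) *: map_mx intr a in
    let W := (Num.sqrt m%:R)^-1 *: map_mx intr b in
    frob_ip G y - 3 * c * frob_sq y <=
    frob_ip G (x *m W) - c * frob_sq (x *m W) - c * frob_sq x
      - kap / 2 * frob_sq W + 5 / 2 * kap * k%:R.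
Proof.
move=> c0 s0 m0 /low_rank_factor[x [W [yE xy Wk]]] kap.
have kap0 : 0 <= kap by rewrite mulr_ge0 ?ler0n ?ltW.
have mR0 : 0 < m%:R :> R by rewrite ltr0n.
pose Phi x (W : 'M[R]_(k, m)) : R := frob_ip G (x *m W) - c * frob_sq (x *m W)
  - c * frob_sq x - kap * frob_sq W.
have := @coordinate_rounding _ _ (Phi x)
  (fun W i j => frob_ip G (x *m delta_mx i j)
    - c * (2 * frob_ip (x *m W) (x *m delta_mx i j))
    - kap * (2 * frob_ip W (delta_mx i j)))
  (fun i j => c * frob_sq (x *m delta_mx i j) + kap) (Num.sqrt m%:R)^-1.
case/(_ _ _ _ W).
- by rewrite invr_gt0 sqrtr_gt0.
- by move=> i j; rewrite addr_ge0// mulr_ge0 ?frob_sq_ge0 ?ltW.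
- move=> A i j u; rewrite /Phi mulmxDr -scalemxAr frob_ipDr frob_ipZr !frob_sqDZ.
  by rewrite frob_sq_delta; ring.
move=> b; set W' := _ *: _ => hW.
have := @coordinate_rounding _ _ (Phi ^~ W')
  (fun x i j => frob_ip G (delta_mx i j *m W')
    - c * (2 * frob_ip (x *m W') (delta_mx i j *m W'))
    - c * (2 * frob_ip x (delta_mx i j)))
  (fun i j => c * frob_sq (delta_mx i j *m W') + c) (Num.sqrt (s / (2 * c))).
case/(_ _ _ _ x).
- by rewrite sqrtr_gt0 divr_gt0// mulr_gt0.
- by move=> i j; rewrite addr_ge0// ?mulr_ge0 ?frob_sq_ge0 ?ltW.
- move=> A i j u; rewrite /Phi mulmxDl -scalemxAl frob_ipDr frob_ipZr !frob_sqDZ.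
  by rewrite frob_sq_delta; ring.
move=> a; set x' := _ *: _ => hx; exists a, b; rewrite -/x' -/W' /=.
have sumW : (Num.sqrt m%:R)^-1 ^+ 2 * \sum_(i < k) \sum_(j < m)
    (c * frob_sq (x *m delta_mx i j) + kap) = c * frob_sq x + kap * k%:R.
  under eq_bigr => i _ do rewrite big_split/= sumr_const card_ord -mulr_sumr.
  rewrite big_split/= -mulr_sumr frob_sq_mul_delta_sum sumr_const card_ord.
  rewrite exprVn sqr_sqrtr ?ler0n// -[kap *+ m *+ k]mulr_natr -[kap *+ m]mulr_natr.
  by field; rewrite gt_eqF.
have sumx : Num.sqrt (s / (2 * c)) ^+ 2 * \sum_(i < q) \sum_(j < k)
    (c * frob_sq (delta_mx i j *m W') + c) = s / 2 * q%:R * (frob_sq W' + k%:R).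
  under eq_bigr => i _ do rewrite big_split/= sumr_const card_ord -mulr_sumr.
  rewrite big_split/= -mulr_sumr frob_sq_delta_mul_sum sumr_const card_ord.
  rewrite sqr_sqrtr ?divr_ge0 ?mulr_ge0 ?ltW//.
  rewrite -[c *+ k *+ q]mulr_natr -[c *+ k]mulr_natr.
  by field; rewrite gt_eqF.
(* In [3 * c], one [c] comes from the penalty on the product, one from that on [x], one from
   rounding [W]. In [5 / 2], the penalty on [W] and its rounding count 1 each and the rounding of
   [x] counts 1/2; the latter also consumes half of the penalty on [W']. *)
move: hx hW; rewrite sumW sumx /Phi -yE => hx hW.
have h1 : kap * frob_sq W <= kap * k%:R by rewrite ler_wpM2l.
have h2 : c * frob_sq x <= c * frob_sq y by rewrite ler_pM2l.
have h3 : s * q%:R <= kap.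
  by rewrite /kap mulrC ler_pM2r// ler_nat leq_addr.
have h4 : s / 2 * q%:R * (frob_sq W' + k%:R) <= kap / 2 * (frob_sq W' + k%:R).
  by rewrite ler_wpM2r ?addr_ge0 ?frob_sq_ge0// mulrAC ler_pM2r.
have : frob_sq (x *m W) = frob_sq y by rewrite -yE.
move=> h5; move: hx hW h1 h2 h4; lra.
Qed.

End Rounding.

(** * Exponential moments of the low-rank noise process *)

Section NoiseMoments.
Context {R : realType} d (Omega : measurableType d) (Pr : probability Omega R).
Context (n m : nat) (sigma : R) (sigma_gt0 : 0 < sigma).
Context (E : 'I_n -> 'I_m -> {RV Pr >-> R}) (iidE : iid_normal_entries sigma E).

Let noise := random_matrix E.

Lemma measurable_noise_entry i j : measurable_fun setT (fun w => noise w i j).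
Proof.
rewrite (_ : (fun w => _) = E i j); first exact: measurable_funP.
by apply/funext => w; rewrite mxE.
Qed.

Lemma measurable_noise_ip U : measurable_fun setT (fun w => frob_ip (noise w) U).
Proof.
under eq_fun do rewrite frob_ipE.
apply: measurable_sum => i; apply: measurable_sum => j.
by apply: measurable_funM => //; exact: measurable_noise_entry.
Qed.

Lemma measurable_noise_row i :
  measurable_fun setT (fun w => frob_sq (row i (noise w))).
Proof.
under eq_fun do rewrite frob_sqE.
apply: measurable_sum => i'; apply: measurable_sum => j.
apply: measurable_funX; under eq_fun do rewrite mxE.
exact: measurable_noise_entry.
Qed.

Lemma noise_mgf U :
  (\int[Pr]_w (expR (frob_ip (noise w) U))%:E =
   (expR (sigma ^+ 2 / 2 * frob_sq U))%:E)%E.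
Proof.
transitivity (\int[Pr]_w (\prod_(ij : 'I_n * 'I_m)
    (fun x => expR (U ij.1 ij.2 * x)) (E ij.1 ij.2 w))%:E)%E.
  apply: eq_integral => w _; rewrite -expR_sum; congr (expR _)%:E.
  rewrite frob_ipE pair_bigA; apply: eq_bigr => ij _.
  by rewrite mxE mulrC.
rewrite (independent_integral_prod (f := fun ij x => expR (U ij.1 ij.2 * x))
  (a := fun ij => expR (sigma ^+ 2 * U ij.1 ij.2 ^+ 2 / 2)) iidE.1).
- rewrite -expR_sum frob_sqE pair_bigA mulr_sumr; congr (expR _)%:E.
  by apply: eq_bigr => ij _; ring.
- by move=> ij; apply: measurableT_comp => //; exact: measurable_funM.
- by move=> ij x; exact: expR_ge0.
- by move=> ij; apply: normal_mgf => //; exact: iidE.2.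
Qed.

Lemma noise_row_sqr_mgf i :
  (\int[Pr]_w (expR (frob_sq (row i (noise w)) / (4 * sigma ^+ 2)))%:E =
   (Num.sqrt 2 ^+ m)%:E)%E.
Proof.
pose f (ij : 'I_n * 'I_m) (x : R) :=
  if ij.1 == i then expR (x ^+ 2 / (4 * sigma ^+ 2)) else 1.
transitivity (\int[Pr]_w (\prod_(ij : 'I_n * 'I_m) f ij (E ij.1 ij.2 w))%:E)%E.
  apply: eq_integral => w _; congr EFin.
  rewrite frob_sqE big_ord1 mulr_suml expR_sum.
  rewrite -(pair_bigA _ (fun i' j => f (i', j) (E i' j w)))/= (bigD1 i)//=.
  rewrite [X in _ = _ * X]big1 ?mulr1 => [|i' /negPf i'i].
    by apply: eq_bigr => j _; rewrite /f eqxx !mxE.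
  by rewrite big1// => j _; rewrite /f/= i'i.
rewrite (independent_integral_prod (f := f)
  (a := fun ij => if ij.1 == i then Num.sqrt 2 else 1) iidE.1).
- rewrite -(pair_bigA _ (fun i' j => if i' == i then Num.sqrt 2 else 1))/=.
  rewrite (bigD1 i)//= eqxx prodr_const card_ord big1 ?mulr1// => i' /negPf i'i.
  by rewrite big1// i'i.
- move=> ij; rewrite /f; case: (ij.1 == i) => //.
  by apply: measurableT_comp => //; exact: measurable_funM.
- by move=> ij x; rewrite /f; case: ifP => // _; exact: expR_ge0.
- move=> ij; rewrite /f; case: (ij.1 == i); last first.
    by rewrite integral_cst// mul1e; exact: probability_setT.
  by apply: normal_sqr_mgf => //; exact: iidE.2.
Qed.

End NoiseMoments.

(** * Gaussian sums over the lattice and the low-rank process *)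

Section LatticeProcess.
Context {R : realType} (c : R) (c_gt0 : 0 < c).

(** Sign and magnitude enumerate the integers of absolute value below [K]. Zero occurs twice, which
    only enlarges the sums to be bounded. *)
Let signed_ord K (t : bool * 'I_K) : int := (-1) ^+ t.1 * t.2%:Z.

Let gauss_wt (z : int) : R := expR (- (c * z%:~R ^+ 2)).

(** Since the square of an integer is at least its absolute value, a geometric series for each of
    the two signs bounds the Gaussian sum. *)
Definition gauss_mass : R := 2 / (1 - expR (- c)).

Lemma expRNc_lt1 : expR (- c) < 1.
Proof. by rewrite -expR0 ltr_expR oppr_lt0. Qed.

Lemma lattice_mass_gt0 : 0 < gauss_mass.
Proof. by rewrite divr_gt0// subr_gt0 expRNc_lt1. Qed.

Lemma ln_gauss_mass_ge0 : 0 <= ln gauss_mass.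
Proof.
rewrite ln_ge0// /gauss_mass ler_pdivlMr ?subr_gt0 ?expRNc_lt1// mul1r.
by have := expR_ge0 (- c); lra.
Qed.

Lemma lattice_mass K : \sum_(t : bool * 'I_K) gauss_wt (signed_ord t) <= gauss_mass.
Proof.
rewrite -(pair_bigA _ (fun b i => gauss_wt (signed_ord (b, i))))/=.
have le b : \sum_(i < K) gauss_wt (signed_ord (b, i)) <= (1 - expR (- c))^-1.
  apply: (@le_trans _ _ (\sum_(i < K) expR (- c) ^+ i)).
    apply: ler_sum => i _; rewrite /gauss_wt /signed_ord/= -expRM_natl ler_expR.
    rewrite mulrN lerN2 [leRHS]mulrC ler_wpM2r ?(ltW c_gt0)//.
    rewrite intrM exprMn -rmorphXn/= sqrr_sign rmorph1 mul1r.
    rewrite -[i%:Z%:~R]/(i%:R) -natrX ler_nat.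
    by case: (i : nat) => // j; rewrite -mulnn leq_pmulr.
  rewrite -[leRHS]mul1r ler_pdivlMr ?subr_gt0 ?expRNc_lt1// mulrC -opprB mulNr.
  by rewrite -subrX1 opprB gerBl exprn_ge0// expR_ge0.
by rewrite big_bool/= /gauss_mass mulrDl mul1r lerD.
Qed.

Lemma lattice_mass_mx K q k :
  \sum_(a : {ffun 'I_q * 'I_k -> bool * 'I_K})
     \prod_ij gauss_wt (signed_ord (a ij)) <= gauss_mass ^+ (q * k).
Proof.
rewrite -(bigA_distr_bigA (fun _ t => gauss_wt (signed_ord t)))/=.
rewrite prodr_const card_prod !card_ord lerXn2r ?nnegrE ?lattice_mass//.
- by apply: sumr_ge0 => t _; exact: expR_ge0.
- exact: ltW lattice_mass_gt0.
Qed.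

(** The boxes exhaust the lattice: each point lies in all large enough boxes, as a limit inferior
    requires. *)
Lemma signed_ord_lift q k (a : 'M[int]_(q, k)) : exists K0, forall K, (K0 <= K)%N ->
  exists a' : {ffun 'I_q * 'I_k -> bool * 'I_K},
    forall i j, a i j = signed_ord (a' (i, j)).
Proof.
exists (\sum_i \sum_j `|a i j|).+1%N => K K0K.
have aK i j : (`|a i j| < K)%N.
  apply: leq_trans K0K; rewrite ltnS.
  by rewrite (bigD1 i)//= (bigD1 j)//= -addnA leq_addr.
exists [ffun ij => (a ij.1 ij.2 < 0, Ordinal (aK ij.1 ij.2))] => i j.
by rewrite ffunE /signed_ord/= -intEsign.
Qed.

Section Process.
Context d (Omega : measurableType d) (Pr : probability Omega R).
Context (n m : nat) (m_gt0 : (0 < m)%N) (sigma : R) (sigma_gt0 : 0 < sigma).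
Context (E : 'I_n -> 'I_m -> {RV Pr >-> R}) (iidE : iid_normal_entries sigma E).

Let noise := random_matrix E.
(** At this value the Gaussian exponent [sigma ^+ 2 / 2 * theta ^+ 2] equals [theta * c], so the
    quadratic penalty exactly cancels the moment generating function. *)
Let theta := 2 * c / sigma ^+ 2.

Let theta_gt0 : 0 < theta.
Proof. by rewrite divr_gt0 ?mulr_gt0// exprn_gt0. Qed.

Lemma process_mgf q (V : 'M[R]_(n, q)) (Z : 'M[R]_(q, m)) : V^T *m V = 1%:M ->
  (\int[Pr]_w (expR (theta * (frob_ip (V^T *m noise w) Z - c * frob_sq Z)))%:E
   = 1)%E.
Proof.
move=> VV.
have exE w : expR (theta * (frob_ip (V^T *m noise w) Z - c * frob_sq Z)) =
    expR (- (theta * c * frob_sq Z)) * expR (frob_ip (noise w) (theta *: (V *m Z))).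
  rewrite -expRD frob_ipZr frob_ip_mull trmxK; congr expR; ring.
under eq_integral do rewrite exE EFinM.
rewrite ge0_integralZl_EFin ?expR_ge0//; last first.
  by apply/measurable_EFinP; apply: measurableT_comp => //; exact: measurable_noise_ip.
rewrite (noise_mgf sigma_gt0 iidE) -EFinM -expRD frob_sqZ frob_sq_orthol//.
rewrite -[RHS]/(1%:E) -[in RHS]expR0; congr (expR _)%:E.
by rewrite /theta; field; rewrite gt_eqF.
Qed.

(* [Psi] is a limit inferior of sums over finite boxes of the lattice, hence the
   extended real values: nothing excludes the value [+oo]. *)
Lemma low_rank_exp_moment_orthonormal q k (V : 'M[R]_(n, q)) : V^T *m V = 1%:M ->
  exists Psi : Omega -> \bar R,
    [/\ measurable_fun setT Psi, (forall w, 0 <= Psi w)%E,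
        (\int[Pr]_w Psi w <= 1)%E &
        forall w (y : 'M[R]_(q, m)), (\rank y <= k)%N ->
          ((expR (theta * (frob_ip (V^T *m noise w) y - 3 * c * frob_sq y)
                  - (5 * c + ln gauss_mass) * ((q + m) * k)%:R))%:E <= Psi w)%E].
Proof.
move=> VV; set s := sigma ^+ 2.
have s0 : 0 < s by rewrite exprn_gt0.
have mass0 := lattice_mass_gt0.
pose xm K (a : {ffun 'I_q * 'I_k -> bool * 'I_K}) :=
  Num.sqrt (s / (2 * c)) *: (\matrix_(i, j) (signed_ord (a (i, j)))%:~R : 'M[R]_(q, k)).
pose Wm K (b : {ffun 'I_k * 'I_m -> bool * 'I_K}) :=
  (Num.sqrt m%:R)^-1 *: (\matrix_(i, j) (signed_ord (b (i, j)))%:~R : 'M[R]_(k, m)).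
pose wt p r K (a : {ffun 'I_p * 'I_r -> bool * 'I_K}) :=
  \prod_ij gauss_wt (signed_ord (a ij)).
have wt0 p r K (a : {ffun 'I_p * 'I_r -> bool * 'I_K}) : 0 <= wt p r K a.
  by apply: prodr_ge0 => ij _; exact: expR_ge0.
have wtE p r K (z : 'M[int]_(p, r)) (a : {ffun 'I_p * 'I_r -> bool * 'I_K}) :
    (forall i j, z i j = signed_ord (a (i, j))) ->
    wt p r K a = expR (- (c * frob_sq (map_mx intr z : 'M[R]_(p, r)))).
  move=> zE; rewrite /wt /gauss_wt -expR_sum sumrN -mulr_sumr frob_sqE pair_bigA.
  congr (expR (- (c * _))); apply: eq_bigr => -[i j] _ /=.
  by rewrite mxE zE.
pose ex K a b w : R := expR (theta * (frob_ip (V^T *m noise w) (xm K a *m Wm K b)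
  - c * frob_sq (xm K a *m Wm K b))).
(* [x] and [W] have [q * k + k * m] entries together, so this bounds the inverse of the total
   lattice weight from below. *)
pose M := (gauss_mass ^+ ((q + m) * k))^-1.
have M0 : 0 < M by rewrite invr_gt0 exprn_gt0.
pose Psi K w := M * \sum_a \sum_b wt q k K a * wt k m K b * ex K a b w.
have Psi0 K w : 0 <= Psi K w.
  apply: mulr_ge0; first exact: ltW.
  apply: sumr_ge0 => a _; apply: sumr_ge0 => b _.
  by rewrite !mulr_ge0 ?expR_ge0.
have mex K a b : measurable_fun setT (ex K a b).
  apply: measurableT_comp => //; apply: measurable_funM => //.
  apply: measurable_funB => //.
  under eq_fun do rewrite frob_ip_mull trmxK.
  exact: measurable_noise_ip.
have mPsi K : measurable_fun setT (fun w => (Psi K w)%:E).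
  apply/measurable_EFinP; apply: measurable_funM => //.
  apply: measurable_sum => a; apply: measurable_sum => b.
  exact: measurable_funM.
have intPsi K : (\int[Pr]_w (Psi K w)%:E <= 1)%E.
  under eq_integral do rewrite EFinM -sumEFin.
  rewrite ge0_integralZl_EFin ?(ltW M0)//; last 2 first.
  - move=> w _; apply: sume_ge0 => a _; rewrite lee_fin.
    by apply: sumr_ge0 => b _; rewrite !mulr_ge0 ?expR_ge0.
  - apply: emeasurable_sum => a; apply/measurable_EFinP; apply: measurable_sum => b.
    exact: measurable_funM.
  rewrite ge0_integral_sum//; last 2 first.
  - move=> a; apply/measurable_EFinP; apply: measurable_sum => b.
    exact: measurable_funM.
  - move=> a w _; rewrite lee_fin.
    by apply: sumr_ge0 => b _; rewrite !mulr_ge0 ?expR_ge0.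
  have inta a : (\int[Pr]_w (\sum_b wt q k K a * wt k m K b * ex K a b w)%:E =
      (\sum_b wt q k K a * wt k m K b)%:E)%E.
    under eq_integral do rewrite -sumEFin.
    rewrite ge0_integral_sum//; last 2 first.
    - by move=> b; apply/measurable_EFinP; exact: measurable_funM.
    - by move=> b w _; rewrite lee_fin !mulr_ge0 ?expR_ge0.
    rewrite -sumEFin; apply: eq_bigr => b _.
    under eq_integral do rewrite EFinM.
    rewrite ge0_integralZl_EFin ?mulr_ge0//; last 2 first.
    - by move=> w _; rewrite lee_fin expR_ge0.
    - exact/measurable_EFinP.
    by rewrite process_mgf// mule1.
  under eq_bigr do rewrite inta.
  rewrite sumEFin -EFinM lee_fin mulrC ler_pdivrMr ?exprn_gt0// mul1r.
  under eq_bigr do rewrite -mulr_sumr.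
  rewrite -mulr_suml mulnDl exprD (mulnC m k).
  apply: ler_pM => //; [| |exact: lattice_mass_mx..].
  - by apply: sumr_ge0.
  - by apply: sumr_ge0.
have PsiE w : limn_einf (fun K => (Psi K w)%:E) =
    limn (fun N => einfs (fun K => (Psi K w)%:E) N) by rewrite limn_einf_lim.
exists (fun w => limn_einf (fun K => (Psi K w)%:E)); split.
- apply: (emeasurable_fun_cvg (fun N w => einfs (fun K => (Psi K w)%:E) N)).
    by move=> N; exact: measurable_fun_einfs.
  by move=> w _; rewrite PsiE; exact: is_cvg_einfs.
- move=> w; rewrite PsiE; apply: lime_ge; first exact: is_cvg_einfs.
  apply: nearW => N; apply: le_ereal_inf_tmp => _ [K _ <-].
  by rewrite lee_fin.
- apply: le_trans.
    by apply: fatou => // K w _; rewrite lee_fin.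
  rewrite limn_einf_lim; apply: lime_le; first exact: is_cvg_einfs.
  apply: nearW => N; apply: le_trans (intPsi N).
  by apply: ereal_inf_lbound; exists N => /=.
- move=> w y yk.
  (* One lattice point dominates [y]; its term alone bounds [Psi K] from below for all large [K]. *)
  have [a [b]] := lattice_domination (V^T *m noise w) c_gt0 s0 m_gt0 yk.
  set x := _ *: _; set W := _ *: _ => /= hy.
  have [Ka hKa] := signed_ord_lift a; have [Kb hKb] := signed_ord_lift b.
  rewrite PsiE; apply: lime_ge; first exact: is_cvg_einfs.
  exists (maxn Ka Kb) => // N /= KN; apply: le_ereal_inf_tmp => _ [K /= NK <-].
  have [a' aE] := hKa K (leq_trans (leq_trans (leq_maxl _ _) KN) NK).
  have [b' bE] := hKb K (leq_trans (leq_trans (leq_maxr _ _) KN) NK).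
  have xE : xm K a' = x.
    by rewrite /x /xm; congr (_ *: _); apply/matrixP => i j; rewrite !mxE aE.
  have WE : Wm K b' = W.
    by rewrite /W /Wm; congr (_ *: _); apply/matrixP => i j; rewrite !mxE bE.
  rewrite lee_fin /Psi.
  apply: (@le_trans _ _ (M * (wt q k K a' * wt k m K b' * ex K a' b' w))); last first.
    rewrite ler_pM2l// (bigD1 a')//= (bigD1 b')//= -addrA lerDl addr_ge0//.
      by apply: sumr_ge0 => b'' _; rewrite !mulr_ge0 ?expR_ge0.
    apply: sumr_ge0 => a'' _; apply: sumr_ge0 => b'' _.
    by rewrite !mulr_ge0 ?expR_ge0.
  (* The mesh of [x] makes its kept penalty match the lattice weight exactly; for [W] there is only
     an inequality, by the factor [(q + m) / m]. *)
  have wta : wt q k K a' = expR (- (theta * c * frob_sq x)).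
    rewrite (wtE _ _ _ _ _ aE); congr (expR (- _)).
    rewrite frob_sqZ sqr_sqrtr ?divr_ge0 ?mulr_ge0 ?ltW// /theta -/s.
    by field; rewrite !gt_eqF.
  have wtb : expR (- (theta * ((q + m)%:R * s / 2) * frob_sq W)) <= wt k m K b'.
    rewrite (wtE _ _ _ _ _ bE) ler_expR lerN2 frob_sqZ exprVn sqr_sqrtr ?ler0n//.
    have mR0 : 0 < m%:R :> R by rewrite ltr0n.
    set S := frob_sq _; have S0 : 0 <= S by exact: frob_sq_ge0.
    have -> : theta * ((q + m)%:R * s / 2) * (m%:R^-1 * S) = c * S * ((q + m)%:R / m%:R).
      by rewrite /theta -/s; field; rewrite !gt_eqF.
    rewrite ler_peMr ?mulr_ge0 ?(ltW c_gt0)// ler_pdivlMr// mul1r ler_nat.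
    exact: leq_addl.
  have ME : M = expR (- (ln gauss_mass * ((q + m) * k)%:R)).
    by rewrite expRN mulrC expRM_natl lnK.
  rewrite ME wta /ex xE WE.
  apply: (@le_trans _ _ (expR (- (ln gauss_mass * ((q + m) * k)%:R)) *
    (expR (- (theta * c * frob_sq x)) *
     expR (- (theta * ((q + m)%:R * s / 2) * frob_sq W)) *
     expR (theta * (frob_ip (V^T *m noise w) (x *m W) - c * frob_sq (x *m W)))))).
    rewrite -!expRD ler_expR.
    have : theta * (5 / 2 * ((q + m)%:R * s) * k%:R) = 5 * c * ((q + m) * k)%:R.
      by rewrite /theta -/s natrM; field; rewrite gt_eqF.
    move: hy; rewrite -(ler_pM2l theta_gt0); lra.
  rewrite ler_pM2l ?expR_gt0// ler_pM2r ?expR_gt0// ler_pM2l ?expR_gt0//.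
Qed.

(** [X *m B] is expressed in an orthonormal basis of the column space of [X]; its coordinate matrix
    has rank at most that of [B] and the same Frobenius norm. *)
Lemma low_rank_exp_moment p q k (X : 'M[R]_(n, p)) : (\rank X <= q)%N ->
  exists Psi : Omega -> \bar R,
    [/\ measurable_fun setT Psi, (forall w, 0 <= Psi w)%E,
        (\int[Pr]_w Psi w <= 1)%E &
        forall w (B : 'M[R]_(p, m)), (\rank B <= k)%N ->
          ((expR (theta * (frob_ip (noise w) (X *m B) - 3 * c * frob_sq (X *m B))
                  - (5 * c + ln gauss_mass) * ((q + m) * k)%:R))%:E <= Psi w)%E].
Proof.
move=> Xq.
have [q' [W [q'X WW XW _]]] := orthonormal_row_basis X^T.
have WX : W^T *m (W *m X) = X.
  by rewrite -[RHS]trmxK -XW !trmx_mul !trmxK mulmxA.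
have VV : W^T^T *m W^T = 1%:M by rewrite trmxK.
have [Psi [mPsi Psi0 intPsi PsiB]] := low_rank_exp_moment_orthonormal k VV.
exists Psi; split => // w B Bk.
have := PsiB w (W *m X *m B) (leq_trans (mxrankM_maxr _ _) Bk).
rewrite trmxK; apply: le_trans; rewrite lee_fin ler_expR.
rewrite -{1 2}WX -!(mulmxA W^T) (frob_ipC (noise w)) frob_ip_mull trmxK frob_ipC.
rewrite frob_sq_orthol// lerD2l lerN2 ler_wpM2l//.
  by rewrite addr_ge0 ?mulr_ge0 ?(ltW c_gt0)// ln_gauss_mass_ge0.
rewrite ler_nat leq_mul2r leq_add2r; apply/orP; right.
by apply: leq_trans q'X _; rewrite mxrank_tr.
Qed.

End Process.

End LatticeProcess.

(** * The deterministic oracle inequality *)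

Section Penalty.
Context {R : realType} (lambda : R) (lambda_gt0 : 0 < lambda).

Lemma P_H_small (t : R) : 0 <= t -> t < lambda -> lambda * t / 2 <= P_H t lambda.
Proof.
move=> t0 tl; rewrite /P_H ger0_norm// tl; nra.
Qed.

Lemma P_H_large (t : R) : lambda <= t -> P_H t lambda = lambda ^+ 2 / 2.
Proof.
move=> lt; rewrite /P_H ger0_norm ?(le_trans (ltW lambda_gt0))//.
by rewrite ltNge lt.
Qed.

Lemma P_H_ge0 (t : R) : 0 <= t -> 0 <= P_H t lambda.
Proof.
move=> t0; have [lt|tl] := leP lambda t.
  by rewrite P_H_large// divr_ge0// sqr_ge0.
apply: le_trans (P_H_small t0 tl).
by rewrite divr_ge0// mulr_ge0// ltW.
Qed.

Lemma P_H_le (t : R) : 0 <= t -> P_H t lambda <= lambda ^+ 2 / 2.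
Proof.
move=> t0; have [lt|tl] := leP lambda t; first by rewrite P_H_large.
by rewrite /P_H ger0_norm// tl; nra.
Qed.

(** On nonnegative arguments [P_H] is nondecreasing and concave and vanishes at 0, hence is
    subadditive; the cases make this polynomial. *)
Lemma P_H_subadditive (t a b : R) : 0 <= t -> 0 <= a -> 0 <= b -> t <= a + b ->
  P_H t lambda <= P_H a lambda + P_H b lambda.
Proof.
move=> t0 a0 b0 tab; have [la|al] := leP lambda a.
  by rewrite (P_H_large la) ler_wpDr ?P_H_ge0 ?P_H_le.
have [lb|bl] := leP lambda b.
  by rewrite (P_H_large lb) ler_wpDl ?P_H_ge0 ?P_H_le.
have [lt|tl] := leP lambda t.
  rewrite P_H_large// /P_H !ger0_norm// al bl.
  have : 0 <= (lambda - a) * (lambda - b) by rewrite mulr_ge0// subr_ge0 ltW.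
  nra.
rewrite /P_H !ger0_norm// al bl tl.
have [abl|lab] := leP (a + b) lambda; first by nra.
have h1 : 0 <= (lambda - a) * (lambda - b) by rewrite mulr_ge0// subr_ge0 ltW.
have h2 : 0 <= (lambda - t) ^+ 2 by rewrite sqr_ge0.
have h3 : 0 <= lambda * (a + b - lambda) by rewrite mulr_ge0 ?ltW// subr_gt0.
nra.
Qed.

End Penalty.

(** * Row-by-row noise bounds and the pointwise inequality *)

Section RowBounds.
Context {R : realType}.

Lemma frobenius_ge0 n m (A : 'M[R]_(n, m)) : 0 <= frobenius A.
Proof. exact: sqrtr_ge0. Qed.

Lemma frob_cauchy_schwarz n m (A B : 'M[R]_(n, m)) :
  frob_ip A B <= frobenius A * frobenius B.
Proof.
have [->|/frob_sq_gt0 A0] := eqVneq A 0.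
  rewrite {1}/frob_ip mul0mx linear0 mulr_ge0 ?frobenius_ge0//.
have [->|/frob_sq_gt0 B0] := eqVneq B 0.
  by rewrite {1}frob_ipC /frob_ip mul0mx linear0 mulr_ge0 ?frobenius_ge0.
have a0 : 0 < frobenius A.
  by rewrite lt0r frobenius_ge0 andbT -sqrf_eq0 frobenius_sqr gt_eqF.
have b0 : 0 < frobenius B.
  by rewrite lt0r frobenius_ge0 andbT -sqrf_eq0 frobenius_sqr gt_eqF.
have := frob_sq_ge0 (frobenius B *: A + (- frobenius A) *: B).
rewrite frob_sqDZ frob_sqZ -!frobenius_sqr (frob_ipC (_ *: _)) frob_ipZr (frob_ipC B).
move=> h; rewrite -(ler_pM2l (mulr_gt0 a0 b0)); lra.
Qed.

Lemma frobenius_triangle n m (A B : 'M[R]_(n, m)) :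
  frobenius (A - B) <= frobenius A + frobenius B.
Proof.
rewrite -(ler_pXn2r (ltn0Sn 1)) ?nnegrE ?addr_ge0 ?frobenius_ge0//.
rewrite frobenius_sqr -scaleN1r frob_sqDZ -!frobenius_sqr.
have := frob_cauchy_schwarz (- A) B.
have -> : frobenius (- A) = frobenius A.
  congr Num.sqrt; apply: eq_bigr => i _; apply: eq_bigr => j _.
  by rewrite mxE sqrrN.
rewrite frob_ipC frob_ipNr frob_ipC; lra.
Qed.

Lemma frob_ip_row n m (A B : 'M[R]_(n, m)) :
  frob_ip A B = \sum_i frob_ip (row i A) (row i B).
Proof.
rewrite frob_ipE; apply: eq_bigr => i _; rewrite frob_ipE big_ord1.
by apply: eq_bigr => j _; rewrite !mxE.
Qed.

Lemma frob_sq_row n m (A : 'M[R]_(n, m)) : frob_sq A = \sum_i frob_sq (row i A).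
Proof. exact: frob_ip_row. Qed.

Lemma frob_sqD_le n m (A B : 'M[R]_(n, m)) :
  frob_sq (A + B) <= 2 * frob_sq A + 2 * frob_sq B.
Proof.
have := frob_sq_ge0 (A + (-1) *: B); rewrite frob_sqDZ.
rewrite -[X in frob_sq (_ + X)](scale1r B) frob_sqDZ; lra.
Qed.

Lemma frob_ip_young n m (A B : 'M[R]_(n, m)) :
  frob_ip A B <= frob_sq B / 8 + 2 * frob_sq A.
Proof. by have := frob_sq_ge0 (B + (-4) *: A); rewrite frob_sqDZ (frob_ipC B); lra. Qed.

Lemma frob_ip_small_row m (lambda rho : R) (N D : 'rV[R]_m) : 0 < lambda -> 0 <= rho ->
  frob_sq N <= lambda ^+ 2 / 16 + rho -> frobenius D < lambda ->
  frob_ip N D <= P_H (frobenius D) lambda / 2 + 2 * rho.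
Proof.
move=> l0 rho0 Nle Dl.
have := P_H_small (frobenius_ge0 D) Dl.
have := frob_cauchy_schwarz N D; move: Nle; rewrite -frobenius_sqr.
have := frobenius_ge0 D; move: Dl; set t := frobenius D; set a := frobenius N.
move=> tl t0 aN ipat PH.
suff : a * t <= lambda * t / 4 + 2 * rho by lra.
rewrite -(ler_pM2l l0).
(* These give [8 * lambda * a <= 16 * a ^+ 2 + lambda ^+ 2], weighted by [t], then the bound on
   [a ^+ 2], then [t < lambda] in the excess term. *)
have h1 : 0 <= t * (4 * a - lambda) ^+ 2 by rewrite mulr_ge0// sqr_ge0.
have h2 : 0 <= t * (lambda ^+ 2 / 16 + rho - a ^+ 2) by rewrite mulr_ge0// subr_ge0.
have h3 : 0 <= rho * (lambda - t) by rewrite mulr_ge0// subr_ge0 ltW.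
lra.
Qed.

(** As a left factor it erases the rows in [J] and can be absorbed into [X], without raising its
    rank. *)
Definition row_mask {n} (J : {set 'I_n}) : 'M[R]_n :=
  diag_mx (\row_i (i \notin J)%:R).

Lemma row_row_mask n m (J : {set 'I_n}) (A : 'M[R]_(n, m)) i :
  row i (row_mask J *m A) = if i \in J then 0 else row i A.
Proof.
rewrite row_mul row_diag_mx -scalemxAl -rowE mxE.
by case: (i \in J); rewrite ?scale0r ?scale1r.
Qed.

(* The term [lambda ^+ 2 / 16 * #|J|] is saved for the union bound over [J]. *)
Lemma noise_row_split n m (lambda s : R) (N D C : 'M[R]_(n, m)) (J : {set 'I_n}) :
  0 < lambda -> 0 < s -> (forall i, (i \in J) = (lambda <= frobenius (row i C))) ->
  frob_ip N (D + C) <= frob_sq (D + C) / 8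
    + \sum_i P_H (frobenius (row i C)) lambda - lambda ^+ 2 / 16 * #|J|%:R
    + (frob_ip N (row_mask J *m D) - frob_sq (row_mask J *m D) / 16)
    + 8 * s * \sum_i expR ((frob_sq (row i N) - lambda ^+ 2 / 16) / (4 * s)).
Proof.
move=> l0 s0 JE.
have -> : #|J|%:R = \sum_i (if i \in J then 1 else 0 : R).
  by rewrite -sum1_card natr_sum big_mkcond.
rewrite (frob_ip_row N) (frob_ip_row N (row_mask J *m D)) !frob_sq_row.
rewrite !mulr_suml !mulr_sumr -sumrB -big_split -sumrB.
rewrite -!big_split/= ler_sum// => i _.
rewrite row_row_mask linearD/=.
have e0 := expR_ge0 ((frob_sq (row i N) - lambda ^+ 2 / 16) / (4 * s)).
(* The excess over [lambda ^+ 2 / 16], in units of [4 * s], is bounded through [u <= expR u]. *)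
have Nrho : frob_sq (row i N) <= lambda ^+ 2 / 16 +
    4 * s * expR ((frob_sq (row i N) - lambda ^+ 2 / 16) / (4 * s)).
  have s40 : 0 < 4 * s by rewrite mulr_gt0.
  rewrite -lerBlDl -[leLHS](mulfVK (lt0r_neq0 s40)) [leLHS]mulrC ler_pM2l//.
  by apply: le_trans (expR_ge1Dx _); rewrite lerDr.
move: e0 Nrho; set e := expR _ => e0 Nrho.
have se0 : 0 <= 4 * s * e by rewrite !mulr_ge0// ltW.
rewrite JE; case: (leP lambda (frobenius (row i C))) => [lt|tl].
  rewrite (P_H_large l0)// frob_sq0 [frob_ip _ 0]frob_ipC {2}/frob_ip mul0mx linear0.
  have := frob_ip_young (row i N) (row i D + row i C).
  have := sqr_ge0 lambda; move: Nrho; lra.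
(* Outside [J], half of [P_H] absorbs the noise against row [i] of [C]. A further quarter covers an
   eighth of that row's squared norm, which arises when the row of [D] is bounded by those of
   [D + C] and [C]. *)
rewrite frob_ipDr.
have := frob_ip_small_row l0 se0 Nrho tl.
have := P_H_small (frobenius_ge0 _) tl.
have : frob_sq (row i C) <= lambda * frobenius (row i C).
  by rewrite -frobenius_sqr expr2 ler_wpM2r ?frobenius_ge0// ltW.
have := frob_sq_ge0 (row i C).
have := frob_sqD_le (row i D + row i C) (- row i C).
rewrite addrK -scaleN1r frob_sqZ; lra.
Qed.

Lemma minimizer_basic_ineq n p m (pen : R -> R -> R) (lambda : R) r
    (X : 'M[R]_(n, p)) (Bs : 'M[R]_(p, m)) (Cs N : 'M[R]_(n, m)) Bh Ch B C :
  is_global_minimizer pen lambda r X (X *m Bs + Cs + N) Bh Ch ->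
  (\rank B <= r)%N ->
  M_loss X (Bh - Bs) (Ch - Cs) / 2 + row_penalty pen lambda Ch <=
  M_loss X (B - Bs) (C - Cs) / 2 + row_penalty pen lambda C
    + frob_ip N (X *m (Bh - B) + (Ch - C)).
Proof.
move=> [_ min] Br; have := min B C Br; rewrite /objective /M_loss !frobenius_sqr.
have E B0 C0 : X *m Bs + Cs + N - X *m B0 - C0 = N + (-1) *: (X *m (B0 - Bs) + (C0 - Cs)).
  by rewrite mulmxBr scaleN1r; apply/matrixP => i j; rewrite !mxE; ring.
have -> : X *m (Bh - B) + (Ch - C) =
    (X *m (Bh - Bs) + (Ch - Cs)) - (X *m (B - Bs) + (C - Cs)).
  by rewrite !mulmxBr; apply/matrixP => i j; rewrite !mxE; ring.
rewrite !E; set Uh := X *m (Bh - Bs) + _; set U := X *m (B - Bs) + _.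
by rewrite !frob_sqDZ (frob_ipDr N Uh) frob_ipNr; lra.
Qed.

Lemma row_penalty_ge0 n m (pen : R -> R -> R) (lambda : R) (A : 'M[R]_(n, m)) :
  0 < lambda -> (forall t, P_H t lambda <= pen t lambda) ->
  0 <= row_penalty pen lambda A.
Proof.
move=> l0 Ppen; apply: sumr_ge0 => i _; apply: le_trans (Ppen _).
by rewrite P_H_ge0// frobenius_ge0.
Qed.

(** Subadditivity lets the two penalties in the basic inequality pay for the [P_H] terms of the
    difference. *)
Lemma row_penalty_sub n m (pen : R -> R -> R) (lambda : R) (A B : 'M[R]_(n, m)) :
  0 < lambda -> (forall t, P_H t lambda <= pen t lambda) ->
  \sum_i P_H (frobenius (row i (A - B))) lambda <=
  row_penalty pen lambda A + row_penalty pen lambda B.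
Proof.
move=> l0 Ppen; rewrite /row_penalty -big_split/=; apply: ler_sum => i _.
rewrite linearB/=; apply: le_trans (lerD (Ppen _) (Ppen _)).
by apply: P_H_subadditive => //; rewrite ?frobenius_ge0//; exact: frobenius_triangle.
Qed.

Lemma oracle_pointwise n p m (pen : R -> R -> R) (lambda s : R) r
    (X : 'M[R]_(n, p)) (Bs : 'M[R]_(p, m)) (Cs N : 'M[R]_(n, m)) Bh Ch B C :
  0 < lambda -> 0 < s -> (forall t, P_H t lambda <= pen t lambda) ->
  is_global_minimizer pen lambda r X (X *m Bs + Cs + N) Bh Ch ->
  (\rank B <= r)%N -> exists J : {set 'I_n},
  M_loss X (Bh - Bs) (Ch - Cs) <=
    3 * M_loss X (B - Bs) (C - Cs) + 8 * row_penalty pen lambda C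
    + 4 * (frob_ip N (row_mask J *m X *m (Bh - B))
         - frob_sq (row_mask J *m X *m (Bh - B)) / 16 - lambda ^+ 2 / 16 * #|J|%:R)
    + 32 * s * \sum_i expR ((frob_sq (row i N) - lambda ^+ 2 / 16) / (4 * s)).
Proof.
move=> l0 s0 Ppen min Br.
pose J := [set i | lambda <= frobenius (row i (Ch - C))]%SET; exists J.
have JE i : (i \in J) = (lambda <= frobenius (row i (Ch - C))) by rewrite inE.
have split := noise_row_split N (X *m (Bh - B)) l0 s0 JE.
have basic := minimizer_basic_ineq C min Br.
have Psub := row_penalty_sub Ch C l0 Ppen.
have : frob_sq (X *m (Bh - B) + (Ch - C)) <=
    2 * M_loss X (Bh - Bs) (Ch - Cs) + 2 * M_loss X (B - Bs) (C - Cs).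
  have -> : X *m (Bh - B) + (Ch - C) =
    (X *m (Bh - Bs) + (Ch - Cs)) + (-1) *: (X *m (B - Bs) + (C - Cs)).
    by rewrite !mulmxBr scaleN1r; apply/matrixP => i j; rewrite !mxE; ring.
  rewrite /M_loss !frobenius_sqr; apply: le_trans (frob_sqD_le _ _) _.
  by rewrite frob_sqZ sqrrN expr1n mul1r.
(* The term [frob_sq (D + C) / 8] of the split costs a quarter of each loss and the penalty of [Ch]
   cancels. A quarter of the loss of the minimizer remains on the left; everything is multiplied by
   4. *)
move: split basic Psub; rewrite !mulmxA; lra.
Qed.

End RowBounds.

(** * Expectation bounds *)

(* Unlike in [ge0_le_integral], no measurability is required; the minimizers
   [Bhat] and [Chat] need not depend measurably on the noise. *)
Lemma ge0_le_integral_nonmeasurable d (T : measurableType d) (R : realType)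
    (mu : {measure set T -> \bar R}) (f g : T -> \bar R) :
  (forall x, 0 <= f x)%E -> (forall x, f x <= g x)%E ->
  (\int[mu]_x f x <= \int[mu]_x g x)%E.
Proof.
move=> f0 fg; have g0 x : (0 <= g x)%E by exact: le_trans (fg x).
rewrite !ge0_integralTE//; apply: ereal_sup_le => _ [h /= hf <-].
by exists h => // x; exact: le_trans (fg x).
Qed.

Lemma sum_subsets_pow (R : realType) n (t : R) :
  \sum_(J : {set 'I_n}) t ^+ #|J| = (t + 1) ^+ n.
Proof.
transitivity (\prod_(i < n) (t + 1)); last by rewrite prodr_const card_ord.
rewrite bigA_distr/=; apply: eq_bigr => J _.
by rewrite -big_mkcond/= prodr_const.
Qed.

(** The total weight of the union bound over row sets is [(1 + expR (- x)) ^+ n], at most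
    [expR (n%:R * expR (- x))], where [expR (- x)] is at most [n%:R^-1]. *)
Lemma sum_subsets_pow_le (R : realType) n (x : R) : (0 < n)%N -> ln n%:R <= x ->
  \sum_(J : {set 'I_n}) expR (- x) ^+ #|J| <= expR 1.
Proof.
move=> n0 nx; rewrite sum_subsets_pow.
apply: (@le_trans _ _ (expR (expR (- x)) ^+ n)).
  by rewrite lerXn2r ?nnegrE ?addr_ge0 ?expR_ge0// addrC expR_ge1Dx.
rewrite -expRM_natl ler_expR mulrC -ler_pdivlMr ?ltr0n// mul1r.
by rewrite -[leRHS]lnK ?posrE ?invr_gt0 ?ltr0n// ler_expR lnV ?posrE ?ltr0n// lerN2.
Qed.

Lemma row_mask_rank (R : realType) n p (J : {set 'I_n}) (X : 'M[R]_(n, p)) :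
  (\rank (row_mask J *m X) <= \rank X)%N.
Proof. exact: mxrankM_maxr. Qed.

Section Assembly.
Context {R : realType} d (Omega : measurableType d) (Pr : probability Omega R).
Context (n m : nat) (n_gt0 : (0 < n)%N) (m_gt0 : (0 < m)%N).
Context (sigma : R) (sigma_gt0 : 0 < sigma).
Context (E : 'I_n -> 'I_m -> {RV Pr >-> R}) (iidE : iid_normal_entries sigma E).
Context (A : R) (A_gt20 : 20 < A).

Let s := sigma ^+ 2.
Let lambda := A * sigma * Num.sqrt (m%:R + ln n%:R).

Let s_gt0 : 0 < s. Proof. by rewrite exprn_gt0. Qed.

Let ln_n_ge0 : 0 <= ln n%:R :> R.
Proof. by rewrite ln_ge0// ler1n. Qed.

Let mln_gt0 : 0 < m%:R + ln n%:R :> R.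
Proof. by rewrite ltr_wpDr// ltr0n. Qed.

Lemma threshold_gt0 : 0 < lambda.
Proof. by rewrite !mulr_gt0 ?sqrtr_gt0// (lt_trans _ A_gt20). Qed.

Let threshold_sqr : lambda ^+ 2 = A ^+ 2 * s * (m%:R + ln n%:R).
Proof. by rewrite !exprMn sqr_sqrtr// ltW. Qed.

Let A_sqr : 400 <= A ^+ 2.
Proof. by have := A_gt20; nra. Qed.

Let exceedance w i :=
  expR ((frob_sq (row i (random_matrix E w)) - lambda ^+ 2 / 16) / (4 * s)).

Lemma measurable_exceedance i : measurable_fun setT (exceedance ^~ i).
Proof.
apply: measurableT_comp => //; apply: measurable_funM => //.
by apply: measurable_funB => //; exact: measurable_noise_row.
Qed.

Lemma integral_exceedance i :
  (\int[Pr]_w (exceedance w i)%:E <= (n%:R^-1)%:E)%E.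
Proof.
have exE w : exceedance w i = expR (- (lambda ^+ 2 / (64 * s))) *
    expR (frob_sq (row i (random_matrix E w)) / (4 * sigma ^+ 2)).
  rewrite -expRD /exceedance -/s; congr expR; field; exact: lt0r_neq0.
under eq_integral do rewrite exE EFinM.
rewrite ge0_integralZl_EFin ?expR_ge0//; last first.
  apply/measurable_EFinP; apply: measurableT_comp => //.
  by apply: measurable_funM => //; exact: measurable_noise_row.
rewrite (noise_row_sqr_mgf sigma_gt0 iidE) -EFinM lee_fin.
(* The threshold gives a factor at most [expR (- (m%:R + ln n%:R))]; its part in [m] beats
   [Num.sqrt 2 ^+ m] and the rest is [n%:R^-1]. *)
apply: (@le_trans _ _ (expR (- (m%:R + ln n%:R)) * expR m%:R)).
  apply: ler_pM; rewrite ?expR_ge0 ?exprn_ge0 ?sqrtr_ge0//.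
    rewrite ler_expR lerN2 threshold_sqr.
    have -> : A ^+ 2 * s * (m%:R + ln n%:R) / (64 * s) =
        (m%:R + ln n%:R) * (A ^+ 2 / 64) by field; exact: lt0r_neq0.
    by rewrite ler_peMr ?(ltW mln_gt0)//; have := A_sqr; lra.
  rewrite -[m%:R]mulr1 expRM_natl lerXn2r ?nnegrE ?sqrtr_ge0 ?expR_ge0//.
  apply: le_trans (expR_ge1Dx 1).
  rewrite -(ler_pXn2r (ltn0Sn 1)) ?nnegrE ?sqrtr_ge0// sqr_sqrtr//; lra.
by rewrite -expRD opprD -addrA addrC addrK -[leLHS]addr0 expRN lnK ?posrE ?ltr0n// addr0.
Qed.

(** Chosen so that [3 * c] is the coefficient [1 / 16] of the masked quadratic term. *)
Let c : R := 48^-1.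
Let c_gt0 : 0 < c. Proof. by rewrite invr_gt0. Qed.

Lemma oracle_expectation p r (X : 'M[R]_(n, p)) (Bs : 'M[R]_(p, m))
    (Cs : 'M[R]_(n, m)) (pen : R -> R -> R) Bh Ch B C :
  (forall t, P_H t lambda <= pen t lambda) ->
  (forall w, is_global_minimizer pen lambda r X
     (X *m Bs + Cs + random_matrix E w) (Bh w) (Ch w)) ->
  (\rank B <= r)%N ->
  ('E_Pr[fun w => M_loss X (Bh w - Bs) (Ch w - Cs)] <=
   (3 * M_loss X (B - Bs) (C - Cs) + 8 * row_penalty pen lambda C
    + 96 * s * ((5 * c + ln (gauss_mass c)) * ((\rank X + m) * (r + r))%:R)
    + 96 * s * expR 1 + 32 * s)%:E)%E.
Proof.
move=> Ppen min Br.
have lambda0 := threshold_gt0.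
set L := _ * ((\rank X + m) * (r + r))%:R.
pose theta := 2 * c / sigma ^+ 2.
have theta0 : 0 < theta by rewrite divr_gt0 ?mulr_gt0 ?exprn_gt0 ?c_gt0.
pose x := theta * (lambda ^+ 2 / 16).
have /choice[Psi PsiP] := fun J : {set 'I_n} => low_rank_exp_moment c_gt0 m_gt0
  sigma_gt0 iidE (r + r) (row_mask_rank J X).
have mPsi J : measurable_fun setT (Psi J) by have [] := PsiP J.
have Psi0 J w : (0 <= Psi J w)%E by have [] := PsiP J.
have intPsi J : (\int[Pr]_w Psi J w <= 1)%E by have [] := PsiP J.
pose a0 := 3 * M_loss X (B - Bs) (C - Cs) + 8 * row_penalty pen lambda C + 96 * s * L.
have L0 : 0 <= L.
  by rewrite mulr_ge0// addr_ge0 ?ln_gauss_mass_ge0// mulr_ge0// ltW.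
have a00 : 0 <= a0.
  have M0 : 0 <= M_loss X (B - Bs) (C - Cs) by rewrite /M_loss sqr_ge0.
  have P0 := row_penalty_ge0 C lambda0 Ppen.
  have sL0 : 0 <= 96 * s * L by rewrite mulr_ge0// mulr_ge0// ltW.
  by rewrite /a0; lra.
(* The union bound over [J] is a weighted sum; the weights correspond to the term
   [lambda ^+ 2 / 16 * #|J|%:R] saved in the row split. *)
pose S w := (\sum_(J : {set 'I_n}) (expR (- x) ^+ #|J|)%:E * Psi J w)%E.
have S0 w : (0 <= S w)%E.
  by apply: sume_ge0 => J _; rewrite mule_ge0// lee_fin exprn_ge0// expR_ge0.
have mS : measurable_fun setT S.
  by apply: emeasurable_sum => J; apply: emeasurable_funM.
have intS : (\int[Pr]_w S w <= (expR 1)%:E)%E.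
  rewrite ge0_integral_sum//; last 2 first.
  - by move=> J; apply: emeasurable_funM.
  - by move=> J w _; rewrite mule_ge0// lee_fin exprn_ge0// expR_ge0.
  apply: (@le_trans _ _ (\sum_(J : {set 'I_n}) (expR (- x) ^+ #|J|)%:E)%E).
    apply: lee_sum => J _.
    rewrite ge0_integralZl_EFin ?exprn_ge0 ?expR_ge0//.
    by rewrite -[leRHS]mule1 lee_wpmul2l// lee_fin exprn_ge0// expR_ge0.
  rewrite sumEFin lee_fin sum_subsets_pow_le//.
  rewrite /x /theta threshold_sqr /c -/s.
  (* The bound 20 on [A] serves here: its square, 400, exceeds 384. *)
  have -> : 2 / 48 / s * (A ^+ 2 * s * (m%:R + ln n%:R) / 16) =
      (m%:R + ln n%:R) * (A ^+ 2 / 384) by field; exact: lt0r_neq0.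
  apply: (@le_trans _ _ (m%:R + ln n%:R)); first by rewrite lerDr.
  by rewrite ler_peMr ?(ltW mln_gt0)//; have := A_sqr; lra.
pose T w := \sum_i exceedance w i.
have T0 w : 0 <= T w by apply: sumr_ge0 => i _; exact: expR_ge0.
have mT : measurable_fun setT T.
  by apply: measurable_sum => i; exact: measurable_exceedance.
have intT : (\int[Pr]_w (T w)%:E <= 1)%E.
  under eq_integral do rewrite -sumEFin.
  rewrite ge0_integral_sum//; last 2 first.
  - by move=> i; apply/measurable_EFinP; exact: measurable_exceedance.
  - by move=> i w _; rewrite lee_fin expR_ge0.
  apply: (@le_trans _ _ (\sum_(i < n) (n%:R^-1)%:E)%E).
    by apply: lee_sum => i _; exact: integral_exceedance.
  rewrite sumEFin lee_fin sumr_const card_ord -[X in X <= _]mulr_natr.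
  by rewrite mulVf// pnatr_eq0 -lt0n.
have s960 : 0 <= 96 * s by rewrite mulr_ge0// ltW.
have s320 : 0 <= 32 * s by rewrite mulr_ge0// ltW.
rewrite unlock.
apply: (@le_trans _ _
  (\int[Pr]_w (a0%:E + ((96 * s)%:E * S w + (32 * s)%:E * (T w)%:E)))%E).
  apply: ge0_le_integral_nonmeasurable => w; first by rewrite lee_fin sqr_ge0.
  have [J] := oracle_pointwise C lambda0 s_gt0 Ppen (min w) Br.
  rewrite -/(T w).
  have rkB : (\rank (Bh w - B)%R <= r + r)%N.
    apply: leq_trans (mxrank_add _ _) _; rewrite mxrank_opp leq_add//.
    by have [] := min w.
  have [_ _ _ /(_ w _ rkB)] := PsiP J.
  set W := frob_ip _ _ - _.
  set W' := frob_ip _ _ - frob_sq _ / 16.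
  have -> : W = W' by rewrite /W /W' /c; congr (_ - _); field.
  rewrite -/theta => PsiJ oracle.
  have SJ : ((expR (- x) ^+ #|J| * expR (theta * W' - L))%:E <= S w)%E.
    rewrite /S (bigD1 J)//= -[leLHS]adde0 leeD//.
      by rewrite EFinM lee_wpmul2l ?lee_fin ?exprn_ge0 ?expR_ge0.
    by apply: sume_ge0 => J' _; rewrite mule_ge0// lee_fin exprn_ge0// expR_ge0.
  apply: (@le_trans _ _ (a0 + (96 * s * (expR (- x) ^+ #|J| * expR (theta * W' - L))
      + 32 * s * T w))%:E); last first.
    rewrite !EFinD leeD2l// leeD2r// EFinM lee_wpmul2l//.
  rewrite lee_fin -expRM_natl -expRD.
  set y := #|J|%:R * - x + (theta * W' - L).
  (* [96 * s] is [4 / theta], so [y <= expR y] turns the exponential moment into a bound on the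
     linear term of the oracle inequality. *)
  have yE : 96 * s * y = 4 * (W' - lambda ^+ 2 / 16 * #|J|%:R) - 96 * s * L.
    by rewrite /y /x /theta /c -/s; field; exact: lt0r_neq0.
  have : 96 * s * y <= 96 * s * expR y.
    by rewrite ler_wpM2l// (le_trans _ (expR_ge1Dx y))// lerDr.
  by move: oracle; rewrite /a0 yE; lra.
have mST : measurable_fun setT (fun w => (96 * s)%:E * S w)%E.
  exact: emeasurable_funM.
have mTT : measurable_fun setT (fun w => (32 * s)%:E * (T w)%:E)%E.
  by apply: emeasurable_funM => //; exact/measurable_EFinP.
rewrite ge0_integralD//; [|by move=> w _; rewrite adde_ge0// mule_ge0// lee_fin|
  exact: emeasurable_funD].
rewrite ge0_integralD//; [|by move=> w _; rewrite mule_ge0// lee_fin|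
  by move=> w _; rewrite mule_ge0// lee_fin].
rewrite !ge0_integralZl_EFin//; [|by move=> w _; rewrite lee_fin|
  exact/measurable_EFinP].
rewrite integral_cst// -/a0 -addrA !EFinD leeD//.
  by rewrite -[leRHS]mule1; apply: lee_wpmul2l; [rewrite lee_fin|exact: probability_le1].
rewrite leeD// ?EFinM; first exact: lee_wpmul2l.
by rewrite -[leRHS]mule1 -EFinM lee_wpmul2l.
Qed.

End Assembly.

Theorem theorem3 (R : realType) :
  exists A0 K : R, 0 < A0 /\ 0 < K /\
  forall (A : R), A0 < A ->
  forall (n p m r : nat), (0 < n)%N -> (0 < p)%N -> (0 < m)%N ->
  forall (sigma : R), 0 < sigma ->
  forall (X : 'M[R]_(n, p)) (Bstar : 'M[R]_(p, m)) (Cstar : 'M[R]_(n, m)),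
  forall (d : measure_display) (Omega : measurableType d)
         (Pr : probability Omega R)
         (E : 'I_n -> 'I_m -> {RV Pr >-> R}),
  iid_normal_entries sigma E ->
  let Y := fun w : Omega => X *m Bstar + Cstar + random_matrix E w in
  let q := \rank X in
  let lambda := A * sigma * Num.sqrt (m%:R + ln n%:R) in
  forall (pen : R -> R -> R),
  pen 0 lambda = 0 -> (forall t : R, P_H t lambda <= pen t lambda) ->
  forall (Bhat : Omega -> 'M[R]_(p, m)) (Chat : Omega -> 'M[R]_(n, m)),
  (forall w : Omega,
     is_global_minimizer pen lambda r X (Y w) (Bhat w) (Chat w)) ->
  forall (B : 'M[R]_(p, m)) (C : 'M[R]_(n, m)), (\rank B <= r)%N ->
  ('E_Pr[fun w : Omega => M_loss X (Bhat w - Bstar) (Chat w - Cstar)] <=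
   (K * (M_loss X (B - Bstar) (C - Cstar)
         + sigma ^+ 2 * (q + m)%:R * r%:R
         + row_penalty pen lambda C
         + sigma ^+ 2))%:E)%E.
Proof.
pose L0 := 5 * 48^-1 + ln (gauss_mass (48^-1 : R)).
have c0 : (0 : R) < 48^-1 by rewrite invr_gt0.
have L00 : 0 <= L0 by rewrite addr_ge0 ?ln_gauss_mass_ge0// mulr_ge0// ltW.
have e0 := expR_ge0 (1 : R).
(* The second witness dominates the coefficients 3 of the loss, 8 of the penalty, [192 * L0] of the
   rank term (doubled by [r + r]) and [96 * expR 1 + 32] of [sigma ^+ 2]. *)
exists 20, (40 + 192 * L0 + 96 * expR 1); split => //; split; first by lra.
move=> A A20 n p m r n0 _ m0 sigma s0 X Bs Cs d Omega Pr E iidE Y q lambda pen _ Ppen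
  Bh Ch min B C Br.
have lambda0 := threshold_gt0 n0 m0 s0 A20.
apply: le_trans (oracle_expectation n0 m0 s0 iidE A20 C Ppen min Br) _.
rewrite lee_fin -/q -/L0 -/lambda.
have M0 : 0 <= M_loss X (B - Bs) (C - Cs) by rewrite /M_loss sqr_ge0.
have P0 := row_penalty_ge0 C lambda0 Ppen.
have Q0 : 0 <= sigma ^+ 2 * (q + m)%:R * r%:R :> R.
  by rewrite mulr_ge0// mulr_ge0// sqr_ge0.
have s20 : 0 <= sigma ^+ 2 by rewrite sqr_ge0.
rewrite [((q + m) * (r + r))%:R]natrM [(r + r)%:R]natrD.
move: M0 P0 Q0 s20; set M := M_loss _ _ _; set P := row_penalty _ _ _.
rewrite -/lambda -/P; set Q := _ * r%:R; set s := sigma ^+ 2 => M0 P0 Q0 s20.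
have -> : 96 * s * (L0 * ((q + m)%:R * (r%:R + r%:R))) = 192 * L0 * Q.
  by rewrite /Q -/s; ring.
have := mulr_ge0 L00 M0; have := mulr_ge0 L00 P0; have := mulr_ge0 L00 s20.
have := mulr_ge0 e0 M0; have := mulr_ge0 e0 P0; have := mulr_ge0 e0 Q0.
lra.
Qed.
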